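(* The foliation $\mathcal{F}_4$ of $\mathbb{P}^2(\mathbb{C})$ described in the affine chart $Z=1$ by $\omega_4=(x+y^2-x^2y)\,\mathrm{d}y+x(x+y^2)\,\mathrm{d}x$ has no invariant algebraic curve. In particular $\mathcal{F}_4$ is not transversally projective.
   Context: A foliation of degree $N$ on $\mathbb{P}^2(\mathbb{C})$ is given, up to a nonzero scalar, by a homogeneous $1$-form $\omega=a\,\mathrm{d}X+b\,\mathrm{d}Y+c\,\mathrm{d}Z$ with $a,b,c$ homogeneous of degree $N+1$ without common factor and $aX+bY+cZ=0$; in the chart $Z=1$, $x=X/Z$, $y=Y/Z$, it is described by the restriction of $\omega$. Here $\mathcal{F}_4$ has degree $2$. An algebraic curve is invariant if, away from the singular points of the foliation, it is a union of leaves (for a curve with reduced equation $f=0$: $f$ divides the coefficients of $\omega\wedge\mathrm{d}f$). A foliation defined by $\omega$ is transversally projective if there are rational $1$-forms $\theta_0,\theta_1,\theta_2$ on $\mathbb{P}^2(\mathbb{C})$, with $\theta_0\neq 0$ defining the foliation, such that $\mathrm{d}\theta_0=\theta_0\wedge\theta_1$, $\mathrm{d}\theta_1=\theta_0\wedge\theta_2$, $\mathrm{d}\theta_2=\theta_1\wedge\theta_2$. *)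

(* Defs.v *)
From mathcomp Require Import all_boot all_order all_algebra.
From mathcomp Require Import ring.
From mathcomp Require Import mpoly.

Set Implicit Arguments.
Unset Strict Implicit.
Unset Printing Implicit Defensive.

Import GRing.Theory.
Local Open Scope ring_scope.

Notation "p ^`M ( i )" := (mderiv i p) : ring_scope.

Lemma quotient_rule (T : comNzRingType) (p q dp dq p' q' dp' dq' : T) :
  p' * q = p * q' -> dp' * q + p' * dq = dp * q' + p * dq' ->
  (dp' * q' - p' * dq') * q ^+ 2 = (dp * q - p * dq) * q' ^+ 2.
Proof.
move=> E dE.
have -> : (dp' * q' - p' * dq') * q ^+ 2 =
    (dp' * q + p' * dq) * (q * q') - (p' * q) * (dq' * q + q' * dq) by ring.
by rewrite dE E; ring.
Qed.

Lemma eq_div_sqr (F : fieldType) (a b c d : F) : b != 0 -> d != 0 ->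
  a * d ^+ 2 = c * b ^+ 2 -> a / b ^+ 2 = c / d ^+ 2.
Proof.
by move=> b0 d0 E; apply/eqP; rewrite eqr_div ?expf_neq0 //; apply/eqP.
Qed.

Lemma F4_identities (T : comNzRingType) (X Y Z : T)
    (a := X * (X * Z + Y ^+ 2))
    (b := X * Z ^+ 2 + Y ^+ 2 * Z - X ^+ 2 * Y)
    (c := - (X ^+ 3 + X * Y * Z + Y ^+ 3)) (U := X ^+ 2 + Y * Z) :
  [/\ a * X + (b * Y + c * Z) = 0, X ^+ 4 = - (X * c + Y * a)
    & Y ^+ 12 = U ^+ 4 * X ^+ 4
      - (Y ^+ 9 - Y ^+ 6 * (X * U) + Y ^+ 3 * (X * U) ^+ 2 - (X * U) ^+ 3) * c].
Proof. by rewrite /a /b /c /U; split; ring. Qed.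

Section Foliations.
Variable C : fieldType.

(* [C] stands for the field of complex numbers. In {mpoly C[3]} the variables
   'X_0, 'X_1, 'X_2 are the homogeneous coordinates X, Y, Z; in {mpoly C[2]}
   the variables 'X_0, 'X_1 are the affine coordinates x, y. *)
Definition mdivides n (d p : {mpoly C[n]}) : Prop := exists q, p = q * d.

(* The homogeneous 1-form w 0 dX + w 1 dY + w 2 dZ. *)
Definition hform := 'I_3 -> {mpoly C[3]}.

(* The units of a polynomial ring over a field are the nonzero constants. *)
Definition is_foliation (N : nat) (w : hform) : Prop :=
  [/\ forall i, w i \is N.+1.-homog,
      forall d, (forall i, mdivides d (w i)) -> d \is a GRing.unit
    & \sum_(i < 3) w i * 'X_i = 0].

(* A curve is given by a reduced (square-free) homogeneous equation of positive
   degree; it need not be irreducible. *)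
Definition is_curve (f : {mpoly C[3]}) : Prop :=
  [/\ f != 0,
      exists2 d, (0 < d)%N & f \is d.-homog
    & forall g, mdivides (g ^+ 2) f -> g \is a GRing.unit].

(* The polynomials [w i * f^`M(j) - w j * f^`M(i)] are the coefficients of
   w /\ df. *)
Definition invariant_curve (w : hform) (f : {mpoly C[3]}) : Prop :=
  is_curve f /\
  forall i j : 'I_3, mdivides f (w i * f^`M(j) - w j * f^`M(i)).

(* p(X, Y, Z) |-> p(x, y, 1) *)
Definition dehomog (p : {mpoly C[3]}) : {mpoly C[2]} :=
  p \mPo [tuple 'X_0; 'X_1; 1].

(* A pair (a, b) stands for the 1-form a dx + b dy in the chart Z = 1. *)
Definition chart (w : hform) : {mpoly C[2]} * {mpoly C[2]} :=
  (dehomog (w 0), dehomog (w 1)).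

(* The function field of the projective plane, written in the chart Z = 1. *)
Notation ratfun := {fraction {mpoly C[2]}}.

(* Partial derivative of a rational function, by the quotient rule on a
   chosen representative; the choice is irrelevant by [rderivE] below. *)
Definition rderiv (i : 'I_2) (u : ratfun) : ratfun :=
  let p := \n_(repr u) in let q := \d_(repr u) in
  tofrac (p^`M(i) * q - p * q^`M(i)) / tofrac q ^+ 2.

(* A rational 1-form on the projective plane is determined by its expression
   a dx + b dy in the chart, with a, b in the function field; rational 2-forms
   are represented by their coefficient on dx /\ dy. *)
Notation ratform := (ratfun * ratfun)%type.

Definition wedge (s t : ratform) : ratfun := s.1 * t.2 - s.2 * t.1.

Definition dform (t : ratform) : ratfun := rderiv 0 t.2 - rderiv 1 t.1.

Definition ratchart (w : hform) : ratform :=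
  (tofrac (chart w).1, tofrac (chart w).2).

(* [t0] defines the foliation of [w] when it is nonzero and proportional to [w]
   over the function field. *)
Definition transversally_projective (w : hform) : Prop :=
  exists t0 t1 t2 : ratform,
    [/\ t0 != 0 /\ wedge t0 (ratchart w) = 0,
        dform t0 = wedge t0 t1,
        dform t1 = wedge t0 t2
      & dform t2 = wedge t1 t2].

(* x(x + y^2) dx + (x + y^2 - x^2 y) dy *)
Definition omega4 : {mpoly C[2]} * {mpoly C[2]} :=
  let x := 'X_0 in let y := 'X_1 in
  (x * (x + y ^+ 2), x + y ^+ 2 - x ^+ 2 * y).

Lemma rderivE (i : 'I_2) (p q : {mpoly C[2]}) : q != 0 ->
  rderiv i (tofrac p / tofrac q) =
  tofrac (p^`M(i) * q - p * q^`M(i)) / tofrac q ^+ 2.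
Proof.
move=> q0; rewrite /rderiv; set u := tofrac p / tofrac q.
set p' := \n_(repr u); set q' := \d_(repr u).
have q'0 : q' != 0 by apply: denom_ratioP.
have uE : tofrac p' = u * tofrac q'.
  rewrite -[u]reprK; unlock tofrac; rewrite -[RHS]FracField.pi_mul.
  apply/eqP; rewrite FracField.equivf_def /FracField.mulf.
  by rewrite !numden_Ratio ?oner_eq0 // ?mulf_neq0 ?oner_eq0 // mulr1 mul1r mulrC.
clearbody p' q'.
have Fq0 : tofrac q != 0 by rewrite tofrac_eq0.
have Fq'0 : tofrac q' != 0 by rewrite tofrac_eq0.
have E : p' * q = p * q'.
  apply/eqP; rewrite -tofrac_eq [X in X == _]tofracM [X in _ == X]tofracM uE.
  by apply/eqP; rewrite mulrAC (divfK Fq0).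
have := congr1 (mderiv i) E; rewrite !mderivM => dE.
have := congr1 (@tofrac _) (quotient_rule E dE).
rewrite [LHS]tofracM [RHS]tofracM !tofracXn => tE.
exact: eq_div_sqr Fq'0 Fq0 tE.
Qed.

(* There is a foliation of degree 2 described by [omega4] in the chart Z = 1:
   the homogenization of [omega4]. *)
Definition F4 : hform := fun i =>
  let X := 'X_0 in let Y := 'X_1 in let Z := 'X_2 in
  [:: X * (X * Z + Y ^+ 2);
      X * Z ^+ 2 + Y ^+ 2 * Z - X ^+ 2 * Y;
      - (X ^+ 3 + X * Y * Z + Y ^+ 3)]`_i.

Lemma F4_chart : chart F4 = omega4.
Proof.
rewrite /chart /F4 /omega4 /dehomog /=.
by rewrite !(rmorphD, rmorphN, rmorphM, rmorphXn) /= !comp_mpolyXU /= !mulr1.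
Qed.

Lemma F4_foliation : is_foliation 2 F4.
Proof.
have hX (i : 'I_3) : ('X_i : {mpoly C[3]}) \is 1.-homog.
  by rewrite dhomogX /= mdeg1.
have [EF EX EY] := F4_identities ('X_0 : {mpoly C[3]}) 'X_1 'X_2.
split=> [i|d dF|].
- have hX2 (j : 'I_3) k : ('X_j : {mpoly C[3]}) ^+ k \is k.-homog.
    by have := dhomogMn k (hX j); rewrite mul1n.
  case: i => [[|[|[|//]]] ?]; rewrite /F4 /=.
  + rewrite (dhomogM (d := 1) (e := 2)) ?hX // rpredD ?hX2 //.
    exact: (dhomogM (d := 1) (e := 1)).
  + rewrite rpredB ?rpredD //.
    * exact: (dhomogM (d := 1) (e := 2)).
    * exact: (dhomogM (d := 2) (e := 1)).
    * exact: (dhomogM (d := 2) (e := 1)).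
  + rewrite rpredN !rpredD ?hX2 //.
    apply: (dhomogM (d := 2) (e := 1)) => //.
    exact: (dhomogM (d := 1) (e := 1)).
- have [[qa Ea] [qc Ec]] := (dF 0, dF 2).
  move: Ea Ec; rewrite /F4 /= => Ea Ec; move: EX EY; rewrite Ea Ec.
  move: ('X_0 ^+ 2 + _) => U EX; move: (_ - _ ^+ 3) => V.
  have {EX} [q EX] : mdivides d ('X_0 ^+ 4).
    by exists (- ('X_0 * qc + 'X_1 * qa)); rewrite EX mulNr mulrDl !mulrA.
  rewrite EX => EY.
  have {EY} [q' EY] : mdivides d ('X_1 ^+ 12).
    by exists (U ^+ 4 * q - V * qc); rewrite EY mulrBl !mulrA.
  have nzX (i : 'I_3) : ('X_i : {mpoly C[3]}) != 0.
    by rewrite -msize_poly_eq0 msizeX.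
  have lX (i : 'I_3) k : mlead (('X_i : {mpoly C[3]}) ^+ k) = (U_(i) *+ k)%MM.
    by rewrite mleadX ?mleadXm.
  have lead (i j : 'I_3) k r : i != j ->
      ('X_i : {mpoly C[3]}) ^+ k = r * d -> mlead d j = 0%N.
    move=> ij E.
    have : r * d != 0 by rewrite -E expf_neq0.
    rewrite mulf_eq0 negb_or => /andP[r0 d0].
    have := congr1 (fun p => mlead p j) E.
    rewrite lX mleadM // mnmDE mulmnE mnm1E (negbTE ij) mul0n => /esym/eqP.
    by rewrite addn_eq0 => /andP[_ /eqP].
  have d0 : d != 0.
    apply/eqP => d0; move/eqP: EX; rewrite d0 mulr0 expf_eq0 /=.
    exact/negP.
  have ld : mlead d = 0%MM.
    apply/mnmP => i; rewrite mnm0E.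
    have [->|i0] := eqVneq i 0; first exact: lead EY.
    by apply: lead EX; rewrite eq_sym.
  have /eqP/msize_poly1P[c c0 ->] : msize d = 1%N by rewrite -mlead_deg // ld mdeg0.
  by apply/unitrP; exists (c^-1)%:MP; rewrite -!mpolyCM mulVf ?mulfV.
- rewrite !big_ord_recl big_ord0 addr0.
  by rewrite (_ : lift ord0 ord0 = 1) ?(_ : lift ord0 1 = 2) //; apply: val_inj.
Qed.

End Foliations.

(* Main.v *)
Require Import Defs.
From HB Require Import structures.
From mathcomp Require Import all_boot all_order all_algebra.
From mathcomp Require Import boolp reals.
From mathcomp Require Import complex.
From mathcomp Require Import ring zify.
From mathcomp Require Import mpoly.

(** Write [omega4 = a dx + b dy] and let [v = b d/dx - a d/dy], a vector field
   tangent to the foliation; its divergence is [delta = 1 - 4 x y].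

   Invariant curves. The affine equation [p] of an invariant curve is a Darboux
   polynomial: [v p = K p] for some polynomial [K]. Comparison of the terms of
   top degree gives [K = c + b y + a x - d x y], where [d] is the degree of [p]
   ([cofactor_shape]). The only singularity is a saddle-node at the origin. In
   the coordinates [s = x + y^2] and [y], with weights 2 and 1, the field [v]
   is the sum of [s d/ds] and of a part that raises weights by 3. Solving
   [v p = K p] by increasing weights, one finds that the lowest part of [p] is
   [s^m y^l] with [d = 4 m] and [l = 7 m] ([darboux_weights]). This
   part contains [y^(9 m)], whence [9 m <= 4 m]: [p] is constant
   ([no_darboux_polynomial]). What remains is the line at infinity, which is
   not invariant ([no_invariant_curve]).

   Transversal projectivity. By a change of gauge a projective triple is
   brought to [theta_0 = omega4] and [theta_1 = (delta / a) dy], and it is then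
   equivalent to a rational solution [k] of
   [v k + 2 delta k = - d/dx (d/dx (delta / a) / a)]
   ([projective_triple_potential]). The right-hand side has poles on [a = 0]
   only. The polynomials that clear the remaining denominators of [k] form an
   ideal stable under [v]. As there are no Darboux polynomials, pseudo-division
   and Gauss's lemma provide a nonzero element of this ideal in [y] alone. There
   [v] acts as [- a d/dy], so differentiation with respect to [y] leads down to
   the constant 1 ([stable_ideal_unit]). So
   [k = P / a^n] with [P] a polynomial, and a comparison of pole orders allows
   to take [n = 3] ([polar_equation_order3]). The equation for [P], restricted
   to the component [x + y^2 = 0] of [a = 0], says that [y^7] divides
   [y^4 (1 + 4 y^3)], a contradiction ([no_polar_solution]). *)

Set Implicit Arguments.
Unset Strict Implicit.
Unset Printing Implicit Defensive.

Import GRing.Theory Num.Theory.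
Local Open Scope ring_scope.
Local Open Scope complex_scope.

(** * Projective triples and their gauge freedom *)

Section ProjectiveTriples.
Variable F : fieldType.

Definition derivation (d : F -> F) : Prop :=
  (forall u v, d (u + v) = d u + d v) /\
  (forall u v, d (u * v) = d u * v + u * d v).

Lemma derivationN d : derivation d -> forall u, d (- u) = - d u.
Proof.
move=> [dD _] u; apply/eqP; rewrite -addr_eq0 -dD addNr.
by rewrite -(inj_eq (addrI (d 0))) -dD !addr0.
Qed.

Lemma derivation_div d : derivation d -> forall u v, v != 0 ->
  d (u / v) = (d u * v - u * d v) / v ^+ 2.
Proof.
by move=> [_ dM] u v v0; have := dM (u / v) v; rewrite divfK // => ->; field.
Qed.

Variables dx dy : F -> F.

Definition fwedge (s t : F * F) : F := s.1 * t.2 - s.2 * t.1.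
Definition fdiff (t : F * F) : F := dx t.2 - dy t.1.

Definition projective_triple (s0 s1 s2 : F * F) : Prop :=
  [/\ fdiff s0 = fwedge s0 s1, fdiff s1 = fwedge s0 s2
    & fdiff s2 = fwedge s1 s2].

Hypothesis derx : derivation dx.
Hypothesis dery : derivation dy.
Hypothesis dxy : forall u, dx (dy u) = dy (dx u).
Let dxD := derx.1.
Let dyD := dery.1.
Let dxM := derx.2.
Let dyM := dery.2.
Let dxN := derivationN derx.
Let dyN := derivationN dery.

(** Rescaling [s0] by [h] is absorbed in [s1] by the logarithmic differential
   [dh / h]; the axioms survive because this form is closed, which is where
   the commutation of [dx] and [dy] enters. *)
Lemma projective_triple_scale h a b s1 s2 : h != 0 ->
    projective_triple (h * a, h * b) s1 s2 ->
  projective_triple (a, b) (s1.1 + dx h / h, s1.2 + dy h / h)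
    (h * s2.1, h * s2.2).
Proof.
case: s1 s2 => [p1 q1] [p2 q2] h0 [].
rewrite /projective_triple /fdiff /fwedge /= => E0 E1 E2; split.
- apply: (mulfI h0); move: E0; rewrite dxM dyM => E0.
  have -> : h * (dx b - dy a) =
      dx h * b + h * dx b - (dy h * a + h * dy a) - (dx h * b - dy h * a) by ring.
  by rewrite E0; field.
- rewrite dxD dyD (derivation_div derx) // (derivation_div dery) // dxy.
  have -> : dx q1 + (dy (dx h) * h - dy h * dx h) / h ^+ 2 -
      (dy p1 + (dy (dx h) * h - dx h * dy h) / h ^+ 2) = dx q1 - dy p1 by ring.
  by rewrite E1; ring.
- rewrite dxM dyM.
  have -> : dx h * q2 + h * dx q2 - (dy h * p2 + h * dy p2) =
      h * (dx q2 - dy p2) + (dx h * q2 - dy h * p2) by ring.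
  by rewrite E2; field.
Qed.

Hypothesis two_neq0 : 2%:R != 0 :> F.

(** The remaining gauge freedom: [s1] is determined by [s0] up to a multiple
   [g] of [s0], and the correction [- dg + g s1 + (g^2 / 2) s0] of [s2] restores
   the second and third structure equations. *)
Lemma projective_triple_shift g a b s1 s2 :
    projective_triple (a, b) s1 s2 ->
  projective_triple (a, b) (s1.1 + g * a, s1.2 + g * b)
    (s2.1 - dx g + g * s1.1 + g ^+ 2 / 2%:R * a,
     s2.2 - dy g + g * s1.2 + g ^+ 2 / 2%:R * b).
Proof.
case: s1 s2 => [p1 q1] [p2 q2] [].
rewrite /projective_triple /fdiff /fwedge /= => E0 E1 E2.
have dhalf d : derivation d -> d (g ^+ 2 / 2%:R) = g * d g.
  move=> dd; have d2 : d 2%:R = 0.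
    have d1 : d 1 = 0.
      by have := dd.2 1 1; rewrite !mul1r mulr1 -{1}[d 1]addr0 => /addrI.
    by rewrite dd.1 d1 addr0.
  by rewrite derivation_div // expr2 dd.2 d2; field; rewrite (natrM _ 2 2) mulf_neq0.
have [c cE] : exists c, g ^+ 2 / 2%:R = c by eexists.
have [dxc dyc] := (dhalf dx derx, dhalf dy dery); rewrite cE in dxc dyc *.
split.
- by rewrite E0; ring.
- rewrite dxD dyD dxM dyM.
  have -> : dx q1 + (dx g * b + g * dx b) - (dy p1 + (dy g * a + g * dy a)) =
      (dx q1 - dy p1) + (dx g * b - dy g * a) + g * (dx b - dy a) by ring.
  by rewrite E0 E1; ring.
- rewrite !(dxD, dyD, dxM, dyM, dxN, dyN) dxc dyc dxy.
  transitivity ((dx q2 - dy p2) + (dx g * q1 - dy g * p1) + g * (dx q1 - dy p1) +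
      g * (dx g * b - dy g * a) + c * (dx b - dy a)).
    by ring.
  by rewrite E0 E1 E2 -cE; field.
Qed.

(** Both gauge freedoms together bring a triple to the normal form
   [s0 = a dx + b dy], [s1 = (delta / a) dy]: the factor of [s0] is scaled away
   and the [dx] component of [s1] is shifted to zero. Then only one function
   is left, [k = (dx component of s2) / a], and the third structure equation
   becomes a first order linear equation for [k] along the vector field
   [b d/dx - a d/dy] that spans the kernel of [s0]. *)
Lemma projective_triple_potential a b s0 s1 s2 :
    a != 0 -> s0 != 0 -> fwedge s0 (a, b) = 0 -> projective_triple s0 s1 s2 ->
  let delta := dx b - dy a in
  exists k, b * dx k - a * dy k + 2%:R * delta * k = - dx (dx (delta / a) / a).
Proof.
case: s0 => [p0 q0] a0 nz0 prop T0 delta.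
have [h p0E q0E] : exists2 h, p0 = h * a & q0 = h * b.
  exists (p0 / a); first by rewrite divfK.
  by move/eqP: prop; rewrite subr_eq0 /= => /eqP prop; rewrite mulrAC prop mulfK.
subst p0 q0.
have h0 : h != 0 by apply: contraNneq nz0 => ->; rewrite !mul0r.
have [p [q [s2' T1]]] : exists p q s2', projective_triple (a, b) (p, q) s2'.
  by do 3!eexists; exact: (projective_triple_scale h0 T0).
have [r [u [v]]] : exists r u v, projective_triple (a, b) (0, r) (u, v).
  have := projective_triple_shift (- (p / a)) T1.
  by rewrite /= mulNr divfK // subrr; do 3!eexists; eassumption.
case; rewrite /fdiff /fwedge /= mulr0 subr0 -/delta mul0r sub0r => E0 E1 E2.
have rE : r = delta / a by rewrite E0; field.
exists (u / a).
have u0 : u = u / a * a by rewrite divfK.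
move: (u / a) u0 => k uE; subst u.
have dy0 : dy 0 = 0 by apply: (addrI (dy 0)); rewrite -dyD !addr0.
have vE : v = dx r / a + b * k.
  by move: E1; rewrite dy0 subr0 => ->; field.
move: E2; rewrite vE rE; move: (dx (delta / a) / a) => m.
rewrite dxD dxM dyM => E2.
transitivity ((dx m + (dx b * k + b * dx k) - (dy k * a + k * dy a)) +
    delta * k - dx m).
  by rewrite /delta; ring.
rewrite E2; field.
exact: a0.
Qed.

End ProjectiveTriples.

(** * Derivations of a fraction field *)

Section QuotientRule.
Variables (R : idomainType) (F : fieldType) (iota : {rmorphism R -> F}).
Hypothesis iota_eq0 : forall p, (iota p == 0) = (p == 0).
Hypothesis iota_frac : forall u, exists p q, q != 0 /\ u = iota p / iota q.

(** [D] is given by the quotient rule only. Everything about such a [D] follows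
   by writing elements as quotients, and it is done over an abstract fraction
   field so that identities are checked on variables. *)
Definition quotient_derivation (d : R -> R) (D : F -> F) : Prop :=
  forall p q, q != 0 ->
  D (iota p / iota q) = iota (d p * q - p * d q) / iota q ^+ 2.

Lemma quotient_derivationP d D :
    {morph d : p q / p + q} -> (forall p q, d (p * q) = d p * q + p * d q) ->
  quotient_derivation d D -> derivation D.
Proof.
move=> dD dM DE; split=> u v; have [p [q [q0 ->]]] := iota_frac u;
  have [r [t [t0 ->]]] := iota_frac v.
- have Fq0 : iota q != 0 by rewrite iota_eq0.
  have Ft0 : iota t != 0 by rewrite iota_eq0.
  have -> : iota p / iota q + iota r / iota t =
     iota (p * t + r * q) / iota (q * t).
    by rewrite rmorphD !rmorphM; field; rewrite ?Fq0 ?Ft0.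
  rewrite !DE ?mulf_neq0 // !dD !dM.
  rewrite !(rmorphB, rmorphD, rmorphM) /=.
  by field; rewrite ?Fq0 ?Ft0.
- have Fq0 : iota q != 0 by rewrite iota_eq0.
  have Ft0 : iota t != 0 by rewrite iota_eq0.
  have -> : iota p / iota q * (iota r / iota t) =
     iota (p * r) / iota (q * t).
    by rewrite !rmorphM; field; rewrite ?Fq0 ?Ft0.
  rewrite !DE ?mulf_neq0 // !dM.
  rewrite !(rmorphB, rmorphD, rmorphM) /=.
  by field; rewrite ?Fq0 ?Ft0.
Qed.

Lemma quotient_derivation_comm d e D E :
    {morph d : p q / p - q} -> (forall p q, d (p * q) = d p * q + p * d q) ->
    {morph e : p q / p - q} -> (forall p q, e (p * q) = e p * q + p * e q) ->
    (forall p, d (e p) = e (d p)) ->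
    quotient_derivation d D -> quotient_derivation e E ->
  forall u, D (E u) = E (D u).
Proof.
move=> dB dM eB eM de DE EE u; have [p [q [q0 ->]]] := iota_frac u.
have Fq0 : iota q != 0 by rewrite iota_eq0.
have q20 : q ^+ 2 != 0 by rewrite expf_neq0.
rewrite EE // DE // -!rmorphXn DE // EE //.
rewrite !expr2 !(dB, eB, dM, eM) !de.
rewrite !(rmorphB, rmorphD, rmorphM) /=.
by field.
Qed.

End QuotientRule.

Section RationalFunctions.
Variable C : fieldType.
Notation ratfun := {fraction {mpoly C[2]}}.

Lemma ratfun_frac (u : ratfun) :
  exists p q, q != 0 /\ u = tofrac p / tofrac q.
Proof.
pose p := \n_(repr u); pose q := \d_(repr u).
have q0 : q != 0 by apply: denom_ratioP.
exists p, q; split=> //.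
suff -> : tofrac p = u * tofrac q by rewrite mulfK // tofrac_eq0.
rewrite -[u in RHS]reprK; unlock tofrac; rewrite -[RHS]FracField.pi_mul.
apply/eqP; rewrite FracField.equivf_def /FracField.mulf.
by rewrite !numden_Ratio ?oner_eq0 // ?mulf_neq0 ?oner_eq0 // mulr1 mul1r mulrC.
Qed.

Lemma rderiv_tofrac (i : 'I_2) (p : {mpoly C[2]}) :
  rderiv i (tofrac p) = tofrac p^`M(i).
Proof.
have d1 : (1 : {mpoly C[2]})^`M(i) = 0 by rewrite -mpolyC1 mderivC.
have := rderivE i p (oner_neq0 {mpoly C[2]}).
by rewrite d1 mulr0 subr0 mulr1 tofrac1 expr1n !divr1.
Qed.

Lemma rderiv_derivation (i : 'I_2) : derivation (@rderiv C i).
Proof.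
apply: (quotient_derivationP (@tofrac_eq0 _) ratfun_frac _ _ (@rderivE _ i)).
- exact: mderivD.
- exact: mderivM.
Qed.

Lemma rderiv_comm (i j : 'I_2) (u : ratfun) :
  rderiv i (rderiv j u) = rderiv j (rderiv i u).
Proof.
apply: (quotient_derivation_comm (@tofrac_eq0 _) ratfun_frac
  _ _ _ _ _ (@rderivE _ i) (@rderivE _ j));
  first [exact: mderivB | exact: mderivM | exact: mderiv_comm].
Qed.

End RationalFunctions.

(** * The coordinates s = x + y^2 and y *)

Section Coordinates.
Variable C : fieldType.
Notation xy := {mpoly C[2]}.
Notation sy := {poly {poly C}}.

(** A property that contains the constants and the variables and is stable
   under sums and products holds for all polynomials; this settles identities
   between ring morphisms and between derivations. *)
Lemma mpoly_subalg_ind (n : nat) (P : {mpoly C[n]} -> Prop) :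
    (forall c, P c%:MP) -> (forall i, P 'X_i) ->
    (forall p q, P p -> P q -> P (p + q)) ->
    (forall p q, P p -> P q -> P (p * q)) ->
  forall p, P p.
Proof.
move=> PC PX PD PM; elim/mpolyind=> [|c m p _ _ Pp]; first by rewrite -mpolyC0.
apply: (PD) => //; rewrite -mul_mpolyC; apply: (PM) => //.
rewrite mpolyXE_id; apply: (big_ind P) => [|//|i _]; first by rewrite -mpolyC1.
elim: (m i) => [|k IH]; first by rewrite expr0 -mpolyC1.
by rewrite exprS; apply: PM.
Qed.

Lemma mderivXU n (i j : 'I_n) : ('X_i : {mpoly C[n]})^`M(j) = (i == j)%:R.
Proof.
rewrite mderivX mnm1E; case: eqP => [->|_]; last by rewrite scale0r.
by rewrite -{1}[U_(j)%MM]add0m addmK mpolyX0 scale1r.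
Qed.

(** The change of coordinates [s = x + y^2]: the outer variable of
   [{poly {poly C}}] is [s], the inner one is [y], and [x] goes to [s - y^2].
   For the weights 2 of [s] and 1 of [y], the lowest weight part of the vector
   field of [omega4] is then the diagonal field [s d/ds]; the outer variable
   also allows pseudo-division in [s]. *)
Definition sy_of_xy : xy -> sy :=
  mmap (polyC \o polyC) (fun i : 'I_2 => [:: 'X - ('X ^+ 2)%:P; 'X%:P]`_i).

HB.instance Definition _ := GRing.RMorphism.on sy_of_xy.

Definition xy_of_sy : sy -> xy :=
  horner_eval ('X_0 + 'X_1 ^+ 2) \o map_poly (horner_alg ('X_1 : xy)).

HB.instance Definition _ := GRing.RMorphism.on xy_of_sy.

Lemma sy_of_xyC c : sy_of_xy c%:MP = c%:P%:P.
Proof. by rewrite /sy_of_xy mmapC. Qed.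

Lemma sy_of_xyX i : sy_of_xy 'X_i = [:: 'X - ('X ^+ 2)%:P; 'X%:P]`_i.
Proof. by rewrite /sy_of_xy mmapX mmap1U. Qed.

Lemma sy_of_xyD (p q : xy) : sy_of_xy (p + q) = sy_of_xy p + sy_of_xy q.
Proof. exact: rmorphD. Qed.

Lemma sy_of_xyB (p q : xy) : sy_of_xy (p - q) = sy_of_xy p - sy_of_xy q.
Proof. exact: rmorphB. Qed.

Lemma sy_of_xyM (p q : xy) : sy_of_xy (p * q) = sy_of_xy p * sy_of_xy q.
Proof. exact: rmorphM. Qed.

Lemma sy_of_xyXn (p : xy) n : sy_of_xy (p ^+ n) = sy_of_xy p ^+ n.
Proof. exact: rmorphXn. Qed.

Lemma sy_of_xy_nat n : sy_of_xy (n%:R : xy) = n%:R.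
Proof. exact: rmorph_nat. Qed.

(** The order of the rules matters: up to conversion a numeral is also a sum, and
   a power is also a product. *)
Definition sy_of_xyE :=
  (sy_of_xy_nat, sy_of_xyB, sy_of_xyD, sy_of_xyXn, sy_of_xyM).

Lemma xy_of_syC c : xy_of_sy c%:P%:P = c%:MP.
Proof.
by rewrite /xy_of_sy /= map_polyC /horner_eval hornerC /= horner_algC -mul_mpolyC mulr1.
Qed.

Lemma xy_of_syY : xy_of_sy 'X%:P = 'X_1.
Proof. by rewrite /xy_of_sy /= map_polyC /horner_eval hornerC /= horner_algX. Qed.

Lemma xy_of_syS : xy_of_sy 'X = 'X_0 + 'X_1 ^+ 2.
Proof. by rewrite /xy_of_sy /= map_polyX /horner_eval hornerX. Qed.

Lemma sy_of_xyK : cancel sy_of_xy xy_of_sy.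
Proof.
elim/mpoly_subalg_ind=> [c|i|p q pE qE|p q pE qE].
- by rewrite sy_of_xyC xy_of_syC.
- rewrite sy_of_xyX; case: i => [[|[|//]] ?] /=.
  + rewrite rmorphB /= xy_of_syS rmorphXn rmorphXn /= xy_of_syY addrK.
    by congr 'X_ _; apply: val_inj.
  + by rewrite xy_of_syY; congr 'X_ _; apply: val_inj.
- by rewrite !rmorphD /= pE qE.
- by rewrite !rmorphM /= pE qE.
Qed.

Lemma xy_of_syK : cancel xy_of_sy sy_of_xy.
Proof.
have KC (q : {poly C}) : sy_of_xy (xy_of_sy q%:P) = q%:P.
  elim/poly_ind: q => [|q c qE]; first by rewrite !rmorph0.
  rewrite rmorphD rmorphM !(rmorphD, rmorphM) /= qE xy_of_syY xy_of_syC.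
  by rewrite sy_of_xyX sy_of_xyC.
elim/poly_ind=> [|p c pE]; first by rewrite !rmorph0.
rewrite !(rmorphD, rmorphM) /= pE KC xy_of_syS !(rmorphD, rmorphXn) /= !sy_of_xyX /=.
by rewrite rmorphXn /= subrK.
Qed.

Definition derivy (f : sy) : sy := map_poly (@deriv C) f.

Lemma coef_derivy f i : (derivy f)`_i = (f`_i)^`().
Proof. by rewrite coef_map_id0 // deriv0. Qed.

Lemma derivyB : {morph derivy : f g / f - g}.
Proof. by move=> f g; apply/polyP => i; rewrite !(coef_derivy, coefB) derivB. Qed.

Lemma derivyD : {morph derivy : f g / f + g}.
Proof. by move=> f g; apply/polyP => i; rewrite !(coef_derivy, coefD) derivD. Qed.

Lemma derivyM f g : derivy (f * g) = derivy f * g + f * derivy g.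
Proof.
apply/polyP => i; rewrite coef_derivy coefD !coefM (raddf_sum (@deriv C)) -big_split.
by apply: eq_bigr => j _; rewrite /= !coef_derivy derivM.
Qed.

Lemma derivyC c : derivy c%:P = (c^`())%:P.
Proof. by rewrite /derivy map_polyC. Qed.

Lemma derivyX : derivy 'X = 0.
Proof.
apply/polyP => i; rewrite coef_derivy coefX coef0.
by case: (_ == _); rewrite ?deriv0 // -polyC1 derivC.
Qed.

(** The chain rule for [s = x + y^2]: [d/dx] becomes [d/ds], and [d/dy] becomes
   [d/dy + 2 y d/ds]. *)
Lemma sy_of_xy_der p :
  sy_of_xy p^`M(0) = (sy_of_xy p)^`() /\
  sy_of_xy p^`M(1) = derivy (sy_of_xy p) + (2%:R * 'X)%:P * (sy_of_xy p)^`().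
Proof.
elim/mpoly_subalg_ind: p => [c|i|p q [p0 p1] [q0 q1]|p q [p0 p1] [q0 q1]].
- by rewrite !mderivC sy_of_xyC derivC derivyC derivC !rmorph0 mulr0 addr0.
- rewrite !mderivXU sy_of_xyX; case: i => [[|[|//]] ?] /=.
  + rewrite derivB derivX derivC subr0 rmorph1 rmorph0 derivyB derivyX derivyC derivXn.
    split=> //; rewrite mulr1 sub0r -rmorphN -rmorphD /=.
    by rewrite expr1 mulr_natl addNr.
  + by rewrite derivC derivyC derivX rmorph0 rmorph1 mulr0 addr0.
- by rewrite !mderivD !sy_of_xyD derivD derivyD p0 p1 q0 q1; split=> //; ring.
- rewrite !mderivM !(sy_of_xyD, sy_of_xyM) derivM derivyM p0 p1 q0 q1.
  move: (sy_of_xy p) (sy_of_xy q) => f g.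
  split=> //; move: (2%:R * 'X)%:P (derivy f) (derivy g) (f^`()) (g^`()) => t u1 u2 u3 u4.
  by ring.
Qed.

End Coordinates.

(** * Total degree of a cofactor *)

Section TotalDegree.
Variable C : fieldType.
Notation xy := {mpoly C[2]}.

Lemma msize_leP n (p : {mpoly C[n]}) k :
  reflect (forall m, p@_m != 0 -> (mdeg m < k)%N) (msize p <= k)%N.
Proof.
apply: (iffP idP) => [le_pk m|le_k].
  by rewrite -mcoeff_msupp => /msize_mdeg_lt /leq_trans; apply.
rewrite msizeE; apply/bigmax_leqP_seq => m; rewrite mcoeff_msupp => pm _.
exact: le_k.
Qed.

Lemma msizeMX_le n (p : {mpoly C[n]}) m : (msize (p * 'X_[m]) <= msize p + mdeg m)%N.
Proof.
have [->|p0] := eqVneq p 0; first by rewrite mul0r msize0.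
by rewrite msizeM ?msizeX ?addnS // -msize_poly_eq0 msizeX.
Qed.

Lemma msize_mderiv_le n i (p : {mpoly C[n]}) : (msize p^`M(i) <= (msize p).-1)%N.
Proof.
apply/msize_leP => m; rewrite mcoeff_mderiv.
have [->|pm _] := eqVneq p@_(m + U_(i)) 0; first by rewrite mul0rn eqxx.
have : (mdeg (m + U_(i)) < msize p)%N by apply: msize_mdeg_lt; rewrite mcoeff_msupp.
by rewrite mdegD mdeg1 addn1; case: (msize p).
Qed.

Lemma mcoeff_euler n (p : {mpoly C[n]}) m :
  (\sum_(i < n) 'X_i * p^`M(i))@_m = (mdeg m)%:R * p@_m.
Proof.
elim/mpolyind: p m => [|c k p _ _ IH] m.
  by rewrite big1 ?mcoeff0 ?mulr0 // => i _; rewrite mderiv0 mulr0.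
under eq_bigr => i _ do rewrite mderivD mderivZ mulrDr.
rewrite big_split !mcoeffD /= IH mulrDr; congr (_ + _).
have -> : \sum_(i < n) 'X_i * (c *: ('X_[k])^`M(i)) = (c * (mdeg k)%:R) *: 'X_[k].
  rewrite mdegE natr_sum mulr_sumr scaler_suml; apply: eq_bigr => i _.
  rewrite mderivX scalerA -scalerAr -mpolyXD.
  have [->|ki] := eqVneq (k i) 0%N; first by rewrite mulr0 !scale0r.
  rewrite addmC submK //; apply/mnm_lepP => l; rewrite mnm1E.
  by case: eqP => // <-; rewrite lt0n.
rewrite !mcoeffZ mcoeffX; case: eqP => [->|_]; last by rewrite !mulr0.
by rewrite !mulr1 mulrC.
Qed.

(** The Euler field multiplies the top degree part of [p] by its degree, so that
   part cancels. *)
Lemma msize_euler_le n (p : {mpoly C[n]}) :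
  (msize (\sum_(i < n) 'X_i * p^`M(i) - (msize p).-1%:R%:MP * p)
     <= (msize p).-1)%N.
Proof.
apply/msize_leP => m; rewrite mcoeffB mcoeff_euler mcoeffCM -mulrBl.
have [->|pm] := eqVneq p@_m 0; first by rewrite mulr0 eqxx.
have : (mdeg m < msize p)%N by apply: msize_mdeg_lt; rewrite mcoeff_msupp.
case: (msize p) => // d; rewrite ltnS /= leq_eqVlt => /orP[/eqP ->|//].
by rewrite subrr mul0r eqxx.
Qed.

(** The vector field [b d/dx - a d/dy] that is killed by
   [omega4 = a dx + b dy]. *)
Definition vfield4 (p : xy) : xy :=
  (omega4 C).2 * p^`M(0) - (omega4 C).1 * p^`M(1).

Lemma mpoly_affine n (p : {mpoly C[n]}) : (msize p <= 2)%N ->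
  p = (p@_0)%:MP + \sum_(i < n) (p@_U_(i))%:MP * 'X_i.
Proof.
move=> /msize_leP p2; apply/mpolyP => m.
rewrite mcoeffD mcoeffC raddf_sum /=.
under eq_bigr => i _ do rewrite mcoeffCM mcoeffX.
have [->|m0] := eqVneq m 0%MM.
  rewrite mulr1 big1 ?addr0 // => i _.
  by rewrite mnm1_eq0 mulr0.
rewrite mulr0 add0r.
have [/eqP/mdeg1P[i /eqP ->]|m1] := eqVneq (mdeg m) 1%N.
  rewrite (bigD1 i) //= eqxx mulr1 big1 ?addr0 // => j ji.
  by rewrite eq_mnm1 (negbTE ji) mulr0.
rewrite big1 => [|i _]; last first.
  have [E|_] := eqVneq U_(i)%MM m; last by rewrite mulr0.
  by rewrite -E mdeg1 in m1.
apply/eqP; apply: contraTT m1 => /p2.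
by rewrite negbK -mdeg_eq0 in m0 *; case: (mdeg m) m0 => [|[|]].
Qed.

(** The part of degree 3 of the vector field is [- x y] times the Euler field.
   Hence [vfield4 p + d x y p], with [d] the degree of [p], has degree at most
   [d + 1], and [K + d x y] has degree at most 1. *)
Lemma cofactor_shape (p K : xy) : p != 0 -> vfield4 p = K * p ->
  exists c b a, K = c%:MP + b%:MP * 'X_1 + a%:MP * 'X_0
    - (msize p).-1%:R%:MP * ('X_0 * 'X_1).
Proof.
move=> p0 vp; set d := (msize p).-1.
pose E : xy := \sum_(i < 2) 'X_i * p^`M(i) - d%:R%:MP * p.
pose K1 : xy := K + d%:R%:MP * ('X_0 * 'X_1).
have EE : E = 'X_0 * p^`M(0) + 'X_1 * p^`M(1) - d%:R%:MP * p.
  rewrite /E !big_ord_recl big_ord0 addr0.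
  by rewrite (_ : lift ord0 ord0 = 1) //; apply: val_inj.
have K1p : K1 * p = p^`M(0) * 'X_0 + p^`M(0) * 'X_[U_(1) *+ 2]
    - p^`M(1) * 'X_[U_(0) *+ 2] - E * 'X_[U_(0) + U_(1)].
  rewrite mpolyXD !mulmS !mulm0n !mpolyXD mpolyX0 !mulr1 EE /K1 mulrDl -vp.
  rewrite /vfield4 /omega4 /=; ring.
have pS : msize p = d.+1 by rewrite /d prednK // lt0n msize_poly_eq0.
have sz : (msize (K1 * p) <= d.+2)%N.
  have bnd k (q : xy) m : (msize q <= k)%N -> (k + mdeg m <= d.+2)%N ->
      (msize (q * 'X_[m]) <= d.+2)%N.
    by move=> qk km; apply: leq_trans (msizeMX_le _ _) (leq_trans _ km); rewrite leq_add2r.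
  have bD (q r : xy) : (msize q <= d.+2)%N -> (msize r <= d.+2)%N ->
      (msize (q + r) <= d.+2)%N.
    by move=> qd rd; apply: leq_trans (msizeD_le _ _) _; rewrite geq_max qd.
  have bN (q : xy) : (msize (- q) <= msize q)%N by rewrite mmeasureN.
  have dp i : (msize p^`M(i) <= d)%N := msize_mderiv_le i p.
  rewrite K1p !bD ?(leq_trans (bN _)) //;
    apply: bnd (dp _) _ || apply: bnd (msize_euler_le p) _;
    by rewrite ?mdegD ?mdegMn ?mdeg1 ?addn1 ?addn2.
have /mpoly_affine K1E : (msize K1 <= 2)%N.
  have [->|K10] := eqVneq K1 0; first by rewrite msize0.
  by move: sz; rewrite msizeM // pS addnS /= -[d.+2]add2n leq_add2r.
exists K1@_0, K1@_U_(1), K1@_U_(0); apply: (addIr (d%:R%:MP * ('X_0 * 'X_1))).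
rewrite subrK -/K1 {1}K1E !big_ord_recl big_ord0 addr0.
rewrite (_ : lift ord0 ord0 = 1); last by apply: val_inj.
by rewrite addrA addrAC.
Qed.

End TotalDegree.

(** * Darboux polynomials at the saddle-node *)

Section Recurrence.
Variable C : numClosedFieldType.
Notation sy := {poly {poly C}}.
Implicit Types (f g : sy) (i j : int).

(** Coefficients of [s^i y^j] extended by zero to all integer exponents, so that
   the recurrences below have no boundary cases. *)
Definition coefz (f : sy) (i j : int) : C :=
  if (i, j) is (Posz k, Posz l) then f`_k`_l else 0.

Lemma coefzD f g i j : coefz (f + g) i j = coefz f i j + coefz g i j.
Proof. by case: i j => [i|i] [j|j]; rewrite /coefz ?addr0 // !coefD. Qed.

Lemma coefzN f i j : coefz (- f) i j = - coefz f i j.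
Proof. by case: i j => [i|i] [j|j]; rewrite /coefz ?oppr0 // !coefN. Qed.

Lemma coefzCM c f i j : coefz (c%:P%:P * f) i j = c * coefz f i j.
Proof. by case: i j => [i|i] [j|j]; rewrite /coefz ?mulr0 // !coefCM. Qed.

Let PoszS_sub1 (n : nat) : n.+1%:Z - 1 = n.
Proof. lia. Qed.

Lemma coefzXM f i j : coefz ('X * f) i j = coefz f (i - 1) j.
Proof.
case: i => [[|i]|i] //; last by rewrite PoszS_sub1; case: j => // j; rewrite /coefz coefXM.
by case: j => // j; rewrite /coefz coefXM coef0.
Qed.

Lemma coefzYM f i j : coefz ('X%:P * f) i j = coefz f i (j - 1).
Proof.
case: i => // i; case: j => [[|j]|j] //; last by rewrite PoszS_sub1 /coefz coefCM coefXM.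
by rewrite /coefz coefCM coefXM.
Qed.

Lemma coefz_deriv f i j : coefz f^`() i j = (i + 1)%:~R * coefz f (i + 1) j.
Proof.
case: i j => [i|[|i]] [j|j] //; rewrite /coefz ?mulr0 ?mul0r //.
by rewrite -PoszD addn1 coef_deriv coefMn mulr_natl.
Qed.

Lemma coefz_derivy f i j : coefz (derivy f) i j = (j + 1)%:~R * coefz f i (j + 1).
Proof.
case: i j => [i|i] [j|[|j]] //; rewrite /coefz ?mulr0 ?mul0r //.
by rewrite -PoszD coef_derivy addn1 coef_deriv mulr_natl.
Qed.

(** [vfield4] in the coordinates [s], [y]. *)
Definition sy_vfield4 (f : sy) : sy :=
  ('X - 'X%:P * ('X - ('X ^+ 2)%:P) * (3%:R * 'X - ('X ^+ 2)%:P)) * f^`()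
  - 'X * ('X - ('X ^+ 2)%:P) * derivy f.

Lemma sy_of_xy_vfield4 p : sy_of_xy (vfield4 p) = sy_vfield4 (sy_of_xy p).
Proof.
have [dx0 dx1] := sy_of_xy_der p.
rewrite /vfield4 /omega4 /= !sy_of_xyE.
rewrite dx0 dx1 !sy_of_xyX /= /sy_vfield4 !(polyC_exp, polyCM).
rewrite [X in X * 'X%:P](_ : _ = 2%:R) ?rmorph_nat //.
by ring.
Qed.

(** Comparison of the coefficients of [s^i y^j]. In terms of the weight
   [2 i + j], the right-hand side only involves strictly smaller weights, by 1
   for [b], by 2 for [a] and by 3 for the other terms. *)
Lemma darboux_recurrence f (c b a d : C) :
    sy_vfield4 f = (c%:P%:P + b%:P%:P * 'X%:P + a%:P%:P * ('X - ('X ^+ 2)%:P)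
      - d%:P%:P * (('X - ('X ^+ 2)%:P) * 'X%:P)) * f ->
  forall i j : int,
    (i%:~R - c) * coefz f i j = b * coefz f i (j - 1)
      + a * (coefz f (i - 1) j - coefz f i (j - 2))
      + (d - 4%:R * i%:~R) * coefz f i (j - 3)
      + (3%:R * (i - 1)%:~R - (j - 1)%:~R - d) * coefz f (i - 1) (j - 1)
      + (i + 1)%:~R * coefz f (i + 1) (j - 5)
      + (j + 1)%:~R * coefz f (i - 2) (j + 1).
Proof.
move=> E i j.
pose S (g : sy) := 'X * g; pose Y (g : sy) := 'X%:P * g.
pose Z x (g : sy) := x%:P%:P * g.
have {}E : S f^`() - Z 3%:R (Y (S (S f^`()))) + Z 4%:R (Y (Y (Y (S f^`()))))
    - Y (Y (Y (Y (Y f^`())))) - S (S (derivy f)) + S (Y (Y (derivy f)))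
  = Z c f + Z b (Y f) + Z a (S f - Y (Y f)) - Z d (Y (S f)) + Z d (Y (Y (Y f))).
  have n3 : (3%:R : sy) = 3%:R%:P%:P by rewrite !rmorph_nat.
  have n4 : (4%:R : sy) = 4%:R%:P%:P by rewrite !rmorph_nat.
  move: E; rewrite /sy_vfield4 /S /Y /Z -n3 -n4 !rmorphXn /= => E.
  transitivity (c%:P%:P * f + (b%:P%:P * 'X%:P + a%:P%:P * ('X - 'X%:P ^+ 2)
      - d%:P%:P * (('X - 'X%:P ^+ 2) * 'X%:P)) * f); last by ring.
  by rewrite -mulrDl !addrA -E; ring.
have := congr1 (fun g => coefz g i j) E.
rewrite /S /Y /Z !(coefzD, coefzN, coefzCM, coefzXM, coefzYM, coefz_deriv, coefz_derivy).
have -> : i - 1 + 1 = i by ring.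
have -> : i - 1 - 1 + 1 = i - 1 by ring.
have -> : j - 1 - 1 - 1 - 1 - 1 = j - 5 by ring.
have -> : j - 1 - 1 - 1 = j - 3 by ring.
have -> : j - 1 - 1 + 1 = j - 1 by ring.
have -> : j - 1 - 1 = j - 2 by ring.
have -> : i - 1 - 1 = i - 2 by ring.
move=> /eqP; rewrite -subr_eq0 => /eqP {}E.
by apply/eqP; rewrite -subr_eq0; apply/eqP; rewrite -[RHS]E; ring.
Qed.

(** This is the computation of the residue along the formal weak separatrix
   of the saddle-node at the origin, carried out on coefficients.
   In the lowest weight [w] the recurrence reads [(i - c) f_ij = 0], so that
   part is a single monomial [s^m y^l] with [c = m]. At exponent [m] of [s] the
   left-hand side always vanishes, which gives one condition on the cofactor
   for each weight: [b = 0] in weight [w + 1], [a = 0] in weight [w + 2],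
   [d = 4 m] in weight [w + 3] and [l = 7 m] in weight [w + 6]. The number 7 is
   the Milnor number of the singularity. *)
Lemma darboux_weights f (c b a d : C) : f != 0 ->
    sy_vfield4 f = (c%:P%:P + b%:P%:P * 'X%:P + a%:P%:P * ('X - ('X ^+ 2)%:P)
      - d%:P%:P * (('X - ('X ^+ 2)%:P) * 'X%:P)) * f ->
  exists m : nat, [/\ d = (4 * m)%:R,
    forall k l, (2 * k + l < 9 * m)%N -> f`_k`_l = 0,
    forall k l, (2 * k + l = 9 * m)%N -> k != m -> f`_k`_l = 0
    & f`_m`_(7 * m) != 0].
Proof.
move=> f0 /darboux_recurrence R.
pose lowest w := [exists i : 'I_w.+1, (f`_i`_(w - 2 * i)%N != 0) && (2 * i <= w)%N].
have ex_w : exists w, lowest w.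
  have : lead_coef (lead_coef f) != 0 by rewrite !lead_coef_eq0.
  rewrite !lead_coefE; set k := (size f).-1; set l := (size _).-1 => kl.
  exists (2 * k + l)%N; apply/existsP.
  have kw : (k < (2 * k + l).+1)%N by lia.
  by exists (Ordinal kw); rewrite /= addKn kl leq_addr.
case: (ex_minnP ex_w) => w /existsP[[m /= _] /andP[Fma mw]] w_min.
set l := (w - 2 * m)%N in Fma.
have wE : w = (2 * m + l)%N by rewrite /l subnKC.
pose F := coefz f.
have F0 : F m l != 0 by [].
have low i j : (2 * i + j < w%:Z)%R -> F i j = 0.
  case: i j => [i|//] [j|//] ijw; apply/eqP; apply: contraTT isT => Fij.
  have : lowest (2 * i + j)%N.
    have kw : (i < (2 * i + j).+1)%N by lia.
    by apply/existsP; exists (Ordinal kw); rewrite /= addKn Fij leq_addr.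
  by move=> /w_min; lia.
have step i j x1 x2 x3 x4 x5 x6 x7 :
    F i (j - 1) = x1 -> F (i - 1) j = x2 -> F i (j - 2) = x3 ->
    F i (j - 3) = x4 -> F (i - 1) (j - 1) = x5 -> F (i + 1) (j - 5) = x6 ->
    F (i - 2) (j + 1) = x7 ->
  (i%:~R - c) * F i j = b * x1 + a * (x2 - x3) + (d - 4%:R * i%:~R) * x4
    + (3%:R * (i - 1)%:~R - (j - 1)%:~R - d) * x5
    + (i + 1)%:~R * x6 + (j + 1)%:~R * x7.
  by move=> <- <- <- <- <- <- <-; exact: R.
have cE : c = m%:Z%:~R.
  have := step m l 0 0 0 0 0 0 0; rewrite !mulr0 subrr mulr0 !addr0.
  do 7!(move=> /(_ ltac:(apply: low; lia))).
  move=> /eqP; rewrite mulf_eq0 subr_eq0 (negbTE F0) orbF.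
  by move=> /eqP <-.
have off i j : (2 * i + j = w%:Z)%R -> i != m -> F i j = 0.
  move=> ijw im; have := step i j 0 0 0 0 0 0 0; rewrite !mulr0 subrr mulr0 !addr0.
  do 7!(move=> /(_ ltac:(apply: low; lia))).
  by move=> /eqP; rewrite mulf_eq0 cE subr_eq0 eqr_int (negbTE im) => /eqP.
have nul x : x * F m l = 0 -> x = 0.
  by move/eqP; rewrite mulf_eq0 (negbTE F0) orbF => /eqP.
have b0 : b = 0.
  have := step m (l%:Z + 1) (F m l) 0 0 0 0 0 0.
  move=> /(_ ltac:(congr (F _ _); lia)).
  do 6!(move=> /(_ ltac:(apply: low; lia))).
  by rewrite cE subrr mul0r subrr !mulr0 !addr0 => /esym/nul.
have a0 : a = 0.
  have := step m (l%:Z + 2) (F m (l%:Z + 1)) 0 (F m l) 0 0 0 0.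
  move=> /(_ ltac:(congr (F _ _); lia)) /(_ ltac:(apply: off; lia)).
  move=> /(_ ltac:(congr (F _ _); lia)).
  do 4!(move=> /(_ ltac:(apply: low; lia))).
  rewrite cE b0 subrr !mul0r sub0r mulrN -mulNr !mulr0 !addr0 add0r => /esym/nul/eqP.
  by rewrite oppr_eq0 => /eqP.
have step' i j x4 x5 x6 x7 :
    F i (j - 3) = x4 -> F (i - 1) (j - 1) = x5 -> F (i + 1) (j - 5) = x6 ->
    F (i - 2) (j + 1) = x7 ->
  (i - m%:Z)%:~R * F i j = (d - 4%:R * i%:~R) * x4
    + (3%:R * (i - 1)%:~R - (j - 1)%:~R - d) * x5
    + (i + 1)%:~R * x6 + (j + 1)%:~R * x7.
  move=> E4 E5 E6 E7; rewrite intrB -cE.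
  rewrite (step i j _ _ _ _ _ _ _ erefl erefl erefl E4 E5 E6 E7).
  by rewrite b0 a0 !mul0r !add0r.
have dE : d = 4%:R * m%:Z%:~R.
  have := step' m (l%:Z + 3) (F m l) 0 0 0.
  move=> /(_ ltac:(congr (F _ _); lia)).
  do 3!(move=> /(_ ltac:(apply: off; lia))).
  rewrite subrr mul0r !mulr0 !addr0 => /esym/nul/eqP.
  by rewrite subr_eq0 => /eqP.
have F1 : F (m%:Z - 1) (l%:Z + 5) = - m%:Z%:~R * F m l.
  have := step' (m%:Z - 1) (l%:Z + 5) 0 0 (F m l) 0.
  do 2!(move=> /(_ ltac:(apply: off; lia))).
  move=> /(_ ltac:(congr (F _ _); lia)) /(_ ltac:(apply: off; lia)).
  rewrite !mulr0 !addr0 add0r subrK => E.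
  by apply/eqP; rewrite -subr_eq0 mulNr opprK -E; apply/eqP; ring.
have F2 : F (m%:Z + 1) (l%:Z + 1) = (3%:R * m%:Z%:~R - l%:Z%:~R - d) * F m l.
  have := step' (m%:Z + 1) (l%:Z + 1) 0 (F m l) 0 0.
  move=> /(_ ltac:(apply: off; lia)) /(_ ltac:(congr (F _ _); lia)).
  do 2!(move=> /(_ ltac:(apply: off; lia))).
  rewrite !mulr0 !addr0 add0r => E.
  have -> : F (m%:Z + 1) (l%:Z + 1) = (m%:Z + 1 - m%:Z)%:~R * F (m%:Z + 1) (l%:Z + 1).
    by ring.
  by rewrite E; ring.
have F3 : F (m%:Z - 2) (l%:Z + 7) = 0.
  have := step' (m%:Z - 2) (l%:Z + 7) 0 0 0 0.
  do 4!(move=> /(_ ltac:(apply: off; lia))).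
  rewrite !mulr0 !addr0 => /eqP; rewrite mulf_eq0 intr_eq0 => /orP[|/eqP //].
  by move=> /eqP; lia.
(* Only [F1] and [F2] contribute in weight [w + 6]: the coefficient of the
   unknown [F m (l + 3)] is zero by [dE]. *)
have lE : l = (7 * m)%N.
  have := step' m (l%:Z + 6) (F m (l%:Z + 3)) (- m%:Z%:~R * F m l)
    ((3%:R * m%:Z%:~R - l%:Z%:~R - d) * F m l) 0.
  move=> /(_ ltac:(congr (F _ _); lia)).
  move=> /(_ ltac:(rewrite -F1; congr (F _ _); lia)).
  move=> /(_ ltac:(rewrite -F2; congr (F _ _); lia)).
  move=> /(_ ltac:(rewrite -F3; congr (F _ _); lia)).
  rewrite subrr mul0r dE subrr mul0r => E.
  have /nul/eqP : (7%:R * m%:Z%:~R - l%:Z%:~R) * F m l = 0 by rewrite [RHS]E; ring.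
  by rewrite subr_eq0 -!pmulrn -natrM eqr_nat => /eqP <-.
exists m; rewrite -lE; split=> // [|k k' kk'|k k' kk' km].
- by rewrite dE -!pmulrn natrM.
- by apply: (low k k'); lia.
- by apply: (off k k'); lia.
Qed.

End Recurrence.

(** * Absence of invariant curves *)

Section NoInvariantCurve.
Variable C : numClosedFieldType.
Notation xy := {mpoly C[2]}.
Notation sy := {poly {poly C}}.

(** [s = y^2] is the line [x = 0]. *)
Lemma size_restrict_x0 (p : xy) : (size (sy_of_xy p).['X ^+ 2] <= msize p)%N.
Proof.
pose h (i : 'I_2) : {poly C} := [:: 0; 'X]`_i.
have -> : (sy_of_xy p).['X ^+ 2] = mmap (@polyC C) h p.
  elim/mpoly_subalg_ind: p => [c|i|p q pE qE|p q pE qE].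
  - by rewrite sy_of_xyC hornerC mmapC.
  - rewrite sy_of_xyX mmapX mmap1U; case: i => [[|[|//]] ?] /=.
    + by rewrite !hornerE subrr.
    + by rewrite hornerC.
  - by rewrite rmorphD hornerD pE qE mmapD.
  - by rewrite rmorphM hornerM pE qE rmorphM.
rewrite /mmap; apply: leq_trans (size_sum _ _ _) _.
apply/bigmax_leqP_seq => m /msize_mdeg_lt mp _; apply: leq_trans mp.
rewrite mul_polyC; apply: leq_trans (size_scale_leq _ _) _.
rewrite /mmap1 !big_ord_recl big_ord0 mulr1 mdegE !big_ord_recl big_ord0 /= addn0.
case: (m ord0) => [|k]; last by rewrite expr0n mul0r size_poly0.
by rewrite expr0 mul1r size_polyXn.
Qed.

Lemma coef_restrict_x0 (f : sy) k :
  (f.['X ^+ 2])`_k = \sum_(i < size f) (if (k < 2 * i)%N then 0 else f`_i`_(k - 2 * i)).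
Proof.
rewrite horner_coef coef_sum; apply: eq_bigr => i _.
by rewrite -exprM coefMXn.
Qed.

(** The lowest weight part of [p] is [(x + y^2)^m y^(7 m)], so the restriction of
   [p] to [x = 0] contains [y^(9 m)] and the degree of [p] is at least [9 m];
   but that degree is [4 m], hence [m = 0] and [p] is constant. *)
Lemma no_darboux_polynomial (p K : xy) :
  vfield4 p = K * p -> p = (p@_0)%:MP.
Proof.
have [->|p0] := eqVneq p 0; first by rewrite mcoeff0 mpolyC0.
move=> vp; have [c [b [a KE]]] := cofactor_shape p0 vp.
pose f := sy_of_xy p.
have f0 : f != 0.
  by apply: contraNneq p0 => f0; rewrite -[p]sy_of_xyK -/f f0 rmorph0.
have vf : sy_vfield4 f = (c%:P%:P + b%:P%:P * 'X%:P + a%:P%:P * ('X - ('X ^+ 2)%:P)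
      - (msize p).-1%:R%:P%:P * (('X - ('X ^+ 2)%:P) * 'X%:P)) * f.
  rewrite -sy_of_xy_vfield4 vp KE ![in LHS](rmorphM, rmorphB, rmorphD) /=.
  by rewrite !sy_of_xyC !sy_of_xyX.
have [m [dE low off top]] := darboux_weights f0 vf.
have m9 : (9 * m < msize p)%N.
  apply: leq_trans (size_restrict_x0 p); rewrite ltnNge; apply: contraNN top => sz.
  have := coef_restrict_x0 f (9 * m).
  rewrite -/f nth_default // => /esym.
  case: (ltnP m (size f)) => [mf|fm]; last first.
    by rewrite [f`_m]nth_default // coef0.
  rewrite (bigD1 (Ordinal mf)) //= ltnNge leq_mul2r orbT /= -mulnBl.
  rewrite big1 ?addr0 => [->//|i im].
  case: ltnP => // im9; apply: off; [lia|exact: im].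
have d4 : (msize p).-1 = (4 * m)%N by apply/eqP; rewrite -(eqr_nat C) dE.
by apply: msize1_polyC; lia.
Qed.

Notation xyz := {mpoly C[3]}.

Lemma dehomogC c : dehomog (c%:MP : xyz) = c%:MP.
Proof. exact: comp_mpolyC. Qed.

Lemma dehomogM : {morph @dehomog C : f g / f * g}.
Proof. by move=> f g; rewrite /dehomog rmorphM. Qed.

Lemma dehomogB : {morph @dehomog C : f g / f - g}.
Proof. by move=> f g; rewrite /dehomog rmorphB. Qed.

Lemma dehomogD : {morph @dehomog C : f g / f + g}.
Proof. by move=> f g; rewrite /dehomog rmorphD. Qed.

Lemma dehomog_der (f : xyz) :
  dehomog f^`M(0) = (dehomog f)^`M(0) /\ dehomog f^`M(1) = (dehomog f)^`M(1).
Proof.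
elim/mpoly_subalg_ind: f => [c|i|f g [f0 f1] [g0 g1]|f g [f0 f1] [g0 g1]].
- by rewrite dehomogC !mderivC -mpolyC0 dehomogC.
- have d1 j : (1 : xy)^`M(j) = 0 by rewrite -mpolyC1 mderivC.
  by rewrite !mderivXU /dehomog !rmorph_nat comp_mpolyXU; case: i => [[|[|[|//]]] ?] /=;
    rewrite ?mderivXU ?d1.
- by rewrite !mderivD !dehomogD !mderivD f0 f1 g0 g1.
- by rewrite !mderivM !(dehomogD, dehomogM) !mderivM f0 f1 g0 g1.
Qed.

Definition affine_mnm (m : 'X_{1..3}) : 'X_{1..2} := [multinom [tuple m 0; m 1]].

Lemma affine_mnmE m : (affine_mnm m 0 = m 0) * (affine_mnm m 1 = m 1).
Proof. by split; rewrite multinomE (tnth_nth 0%N). Qed.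

Lemma mdeg3 (m : 'X_{1..3}) : mdeg m = (m 0%R + m 1%R + m 2%R)%N.
Proof.
rewrite mdegE !big_ord_recl big_ord0 addn0 -addnA.
by congr (_ + (m _ + m _))%N; apply: val_inj.
Qed.

Lemma mnm3P (m k : 'X_{1..3}) : m 0 = k 0 -> m 1 = k 1 -> m 2 = k 2 -> m = k.
Proof.
move=> m0 m1 m2; apply/mnmP => -[[|[|[|//]]] lti].
- by rewrite (_ : Ordinal lti = 0) //; apply: val_inj.
- by rewrite (_ : Ordinal lti = 1) //; apply: val_inj.
- by rewrite (_ : Ordinal lti = 2) //; apply: val_inj.
Qed.

(** Setting [Z = 1] merges no monomials of a homogeneous polynomial. *)
Lemma mcoeff_dehomog d (f : xyz) m : f \is d.-homog -> mdeg m = d ->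
  (dehomog f)@_(affine_mnm m) = f@_m.
Proof.
move=> /dhomogP fd md; rewrite [in RHS](mpolyE f) /dehomog comp_mpolyE !raddf_sum.
apply: eq_big_seq => k kf /=; rewrite !mcoeffZ mcoeffX; congr (_ * _).
have -> : \prod_(i < 3) tnth [tuple 'X_0; 'X_1; 1] i ^+ k i = 'X_[affine_mnm k] :> xy.
  have l2 : lift ord0 ord0 = 1 :> 'I_2 by apply: val_inj.
  have l3 : lift ord0 ord0 = 1 :> 'I_3 by apply: val_inj.
  rewrite [RHS]mpolyXE_id !big_ord_recl !big_ord0 /= l2 l3 !affine_mnmE.
  by rewrite !(tnth_nth 0) /= expr1n !mulr1.
rewrite mcoeffX; suff -> : (affine_mnm k == affine_mnm m) = (k == m) by [].
apply/eqP/eqP => [E|-> //].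
have k0 : k 0 = m 0 by rewrite -!affine_mnmE E.
have k1 : k 1 = m 1 by rewrite -!affine_mnmE E.
by apply: mnm3P => //; have := fd _ kf; move: md; rewrite /= !mdeg3; lia.
Qed.

Lemma coef_omega4 : (omega4 C).1@_(U_(0%R) + U_(1%R) *+ 2)%MM = 1.
Proof.
rewrite /omega4 /= mulrDr mcoeffD mpolyXn -!mpolyXD !mcoeffX eqxx eqm_add2l.
case: eqP => [/mnmP/(_ 0)|]; last by rewrite add0r.
by rewrite mulmnE !mnm1E.
Qed.

(** The affine part of an invariant curve is constant by
   [no_darboux_polynomial], so its equation is a multiple of a power of
   [Z]. Its invariance makes [Z] divide
   [w 0], which contains the monomial [X Y^2]. *)
Lemma no_invariant_curve (w : hform C) : is_foliation 2 w ->
    (exists2 c : C, c != 0 & chart w = c *: omega4 C) ->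
  ~ exists f, invariant_curve w f.
Proof.
move=> [w_homog _ _] [c c0 wE] [f [[f0 [d d_gt0 fd] _] f_inv]].
have w0E : dehomog (w 0) = c *: (omega4 C).1 by have := congr1 fst wE.
have w1E : dehomog (w 1) = c *: (omega4 C).2 by have := congr1 snd wE.
have [dx dy] := dehomog_der f.
have [q qE] := f_inv 0 1.
have pC : dehomog f = ((dehomog f)@_0)%:MP.
  apply: (no_darboux_polynomial (K := (- c^-1)%:MP * dehomog q)).
  have := congr1 (@dehomog C) qE; rewrite dehomogB !dehomogM dx dy w0E w1E.
  rewrite -mulrA => <-; rewrite /vfield4 -!mul_mpolyC.
  have cV : (- c^-1)%:MP_[2] * c%:MP_[2] = -1 by rewrite -mpolyCM mulNr mulVf // mpolyCN.
  by rewrite -[LHS]opprK -mulN1r -cV; ring.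
have fcoef m : m != (U_(2%R) *+ d)%MM -> f@_m = 0.
  move=> mZ; have [md|md] := eqVneq (mdeg m) d; last first.
    by apply: dhomog_nemf_coeff fd _.
  rewrite -(mcoeff_dehomog fd md) pC mcoeffC.
  have [E|_] := eqVneq (affine_mnm m) 0%MM; last by rewrite mulr0.
  case/eqP: mZ; move: (affine_mnmE m); rewrite E !mnm0E => -[m0 m1].
  apply: mnm3P; rewrite mulmnE mnm1E -?m0 -?m1 ?mul0n //.
  by move: md; rewrite mdeg3 -m0 -m1 /= mul1n.
pose z := f@_(U_(2%R) *+ d)%MM.
have fE : f = z%:MP * 'X_2 ^+ d.
  apply/mpolyP => m; rewrite mcoeffCM mpolyXn mcoeffX.
  have [<-|mZ] := eqVneq (U_(2%R) *+ d)%MM m; first by rewrite mulr1.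
  by rewrite mulr0 fcoef // eq_sym.
have z0 : z != 0 by apply: contraNneq f0 => z0; rewrite fE z0 mpolyC0 mul0r.
have [r rE] := f_inv 0 2.
have [r' w0Z] : exists r', w 0 = r' * 'X_2.
  case: d d_gt0 {fd fcoef qE pC} @z fE z0 => // d _ z fE z0.
  have Zd : ('X_2 : xyz) ^+ d != 0 by rewrite expf_neq0 // -msize_poly_eq0 msizeX.
  have fx : f^`M(0) = 0.
    rewrite fE mpolyXn mderiv_mulC mderivX mulmnE mnm1E mul0n scale0r.
    exact: mulr0.
  have fz : f^`M(2) = (z * d.+1%:R)%:MP * 'X_2 ^+ d.
    rewrite fE mpolyXn mderiv_mulC mderivX mulmnE mnm1E eqxx mul1n.
    by rewrite mulmSr addmK -mul_mpolyC mpolyCM -mulrA mpolyXn.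
  have zd0 : z * d.+1%:R != 0 by rewrite mulf_neq0 // pnatr_eq0.
  exists ((z * d.+1%:R)^-1%:MP * (r * z%:MP)); apply: (mulIf Zd).
  transitivity ((z * d.+1%:R)^-1%:MP * (w 0 * f^`M(2) - w 2 * f^`M(0))).
    rewrite fx fz mulr0 subr0 mulrCA; congr (_ * _).
    by rewrite mulrA -mpolyCM mulVf // mul1r.
  by rewrite rE fE exprS; ring.
have := mcoeff_dehomog (m := (U_(0%R) + U_(1%R) *+ 2)%MM) (w_homog 0).
rewrite mdegD mdegMn !mdeg1 => /(_ erefl).
have -> : (affine_mnm (U_(0%R) + U_(1%R) *+ 2) = U_(0%R) + U_(1%R) *+ 2)%MM.
  apply/mnmP => -[[|[|//]] lti].
  - by rewrite multinomE (tnth_nth 0%N) !(mnmDE, mulmnE, mnm1E).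
  - by rewrite multinomE (tnth_nth 0%N) !(mnmDE, mulmnE, mnm1E).
rewrite w0E mcoeffZ coef_omega4 mulr1 w0Z => cE.
move: c0; rewrite cE -mcoeff_msupp => /msuppM_le/allpairsP[[m1 m2] /= [_]].
rewrite msuppX inE => /eqP -> /mnmP/(_ 2).
by rewrite !(mnmDE, mulmnE, mnm1E) eqxx addn1.
Qed.

End NoInvariantCurve.

(** * Denominators of a potential *)

Section Denominators.
Variables (T : idomainType) (D : T -> T) (a dl N A B : T).
Hypothesis DM : forall f g, D (f * g) = D f * g + f * D g.
Hypothesis B0 : B != 0.
Hypothesis E : a ^+ 4 * (D A * B - A * D B + 2%:R * dl * A * B) = N * B ^+ 2.

Lemma derivation_expr n : a * D (a ^+ n) = n%:R * D a * a ^+ n.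
Proof.
elim: n => [|n IH].
  have D1 : D 1 = 0 by have := DM 1 1; rewrite !mul1r mulr1 -{1}[D 1]addr0 => /addrI.
  by rewrite expr0 D1 mulr0 !mul0r.
rewrite exprS DM mulrDr [a * (a * D _)]mulrA -mulrA [a * D (a ^+ n)]IH.
by rewrite -[n.+1]addn1 natrD; ring.
Qed.

(** The denominators of [A / B] after inverting [a]. *)
Definition denominator (c : T) : Prop := exists n P, c * a ^+ n * A = P * B.

Lemma denominatorMl e c : denominator c -> denominator (e * c).
Proof. by move=> [n [P H]]; exists n, (e * P); rewrite -!mulrA -H; ring. Qed.

Lemma denominatorB c e : denominator c -> denominator e -> denominator (c - e).
Proof.
move=> [n [P HP]] [k [Q HQ]]; exists (n + k)%N, (a ^+ k * P - a ^+ n * Q).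
transitivity (a ^+ k * (c * a ^+ n * A) - a ^+ n * (e * a ^+ k * A)).
  by rewrite exprD; ring.
by rewrite HP HQ; ring.
Qed.

Lemma denominator_cancel c : denominator (a * c) -> denominator c.
Proof. by move=> [n [P H]]; exists n.+1, P; rewrite -H exprS; ring. Qed.

(** Applying [D] to [c k = P / a^n], where [k = A / B], and replacing [D k] by the
   right-hand side of [E], which has no other pole than [a], shows that
   [D c] clears the denominators of [k] as well. *)
Lemma denominator_der c : denominator c -> denominator (D c).
Proof.
move=> [n [P H]].
have DH : D c * a ^+ n * A + c * D (a ^+ n) * A + c * a ^+ n * D A = D P * B + P * D B.
  by rewrite -DM -H !DM; ring.
have aD := derivation_expr n.
exists (n + 4)%N, (a ^+ 4 * D P - n%:R * a ^+ 3 * D a * P - c * a ^+ n * N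
  + 2%:R * dl * a ^+ 4 * P).
apply: (mulIf B0).
transitivity (a ^+ 4 * B * (D c * a ^+ n * A + c * D (a ^+ n) * A + c * a ^+ n * D A)
   - a ^+ 3 * B * A * c * (a * D (a ^+ n))
   - c * a ^+ n * (a ^+ 4 * (D A * B - A * D B + 2%:R * dl * A * B))
   - (c * a ^+ n * A) * (a ^+ 4 * D B - 2%:R * dl * a ^+ 4 * B)).
  by rewrite exprD; ring.
rewrite DH aD E.
transitivity (a ^+ 4 * B * (D P * B + P * D B)
   - a ^+ 3 * B * n%:R * D a * (c * a ^+ n * A)
   - c * a ^+ n * (N * B ^+ 2)
   - (c * a ^+ n * A) * (a ^+ 4 * D B - 2%:R * dl * a ^+ 4 * B)).
  by ring.
by rewrite H; ring.
Qed.

Lemma denominator1_equation n P : a ^+ n * A = P * B ->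
  a ^+ 4 * (a * D P - n%:R * P * D a + 2%:R * dl * a * P) = N * a ^+ n.+1.
Proof.
move=> H; have B20 : B ^+ 2 != 0 by rewrite expf_neq0.
have DH : D (a ^+ n) * A + a ^+ n * D A = D P * B + P * D B.
  by rewrite -!DM H.
have aD := derivation_expr n.
apply: (mulIf B20).
transitivity (a ^+ n.+1 * (N * B ^+ 2)); last by ring.
rewrite -E [a ^+ n.+1]exprS.
transitivity (a ^+ 4 * (a * B * (D (a ^+ n) * A + a ^+ n * D A)
   - B * A * (a * D (a ^+ n)) - a * D B * (a ^+ n * A)
   + 2%:R * dl * a * B * (a ^+ n * A))); last by ring.
rewrite DH aD.
transitivity (a ^+ 4 * (a * B * (D P * B + P * D B)
   - B * n%:R * D a * (a ^+ n * A) - a * D B * (a ^+ n * A)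
   + 2%:R * dl * a * B * (a ^+ n * A))); last by ring.
by rewrite H; ring.
Qed.

End Denominators.

Section Gauss.
Variable C : closedFieldType.
Notation sy := {poly {poly C}}.

Definition at_y (t : C) (f : sy) : {poly C} := map_poly (horner_eval t) f.

(** Over an algebraically closed field the primes of [{poly C}] are the
   [y - t], so a polynomial in [s] has content 1 when it does not vanish
   identically on any line [y = t]. *)
Definition primitive (f : sy) : Prop := forall t, at_y t f != 0.

Lemma at_yM t f g : at_y t (f * g) = at_y t f * at_y t g.
Proof. exact: rmorphM. Qed.

Lemma at_y_eq0 t f : at_y t f = 0 -> exists g, f = ('X - t%:P)%:P * g.
Proof.
move=> f0; exists (map_poly (fun q => q %/ ('X - t%:P)) f).
apply/polyP => i; rewrite coefCM coef_map_id0 ?div0p // mulrC divpK //.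
rewrite dvdp_XsubCl /root.
by have /polyP/(_ i) := f0; rewrite coef_map coef0 /= /horner_eval => ->.
Qed.

Lemma at_yC t c : at_y t c%:P = (c.[t])%:P.
Proof. exact: map_polyC. Qed.

Lemma closed_root (c : {poly C}) : (1 < size c)%N -> exists t, root c t.
Proof. by move=> c1; apply/closed_rootP; rewrite neq_ltn c1 orbT. Qed.

(** Gauss's lemma: the linear factors of [c] are cancelled one at a time,
   specialisation at a root of [c] being a morphism to an integral domain. *)
Lemma gauss c (f g h : sy) : c != 0 -> primitive h ->
  c%:P * f = g * h -> exists k, f = k * h.
Proof.
move=> c0 h_prim; have [n] := ubnP (size c).
elim: n c c0 f g => // n IH c c0 f g; rewrite ltnS => cn E.
have [c1|c1] := leqP (size c) 1%N.
  have [z cE] : exists z, c = z%:P by exists c`_0; apply: size1_polyC.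
  have z0 : z != 0 by apply: contraNneq c0 => z0; rewrite cE z0.
  exists ((z^-1)%:P%:P * g); rewrite -mulrA -E mulrA cE -!polyCM mulVf //.
  by rewrite mul1r.
have [t ct] := closed_root c1.
have /at_y_eq0[g' gE] : at_y t g = 0.
  have := congr1 (at_y t) E; rewrite !at_yM at_yC (eqP ct) mul0r => /esym/eqP.
  by rewrite mulf_eq0 (negbTE (h_prim t)) orbF => /eqP.
have /factor_theorem[c' cE] := ct.
have Xt0 : ('X - t%:P : {poly C}) != 0 by rewrite polyXsubC_eq0.
have c'0 : c' != 0 by apply: contraNneq c0 => c'0; rewrite cE c'0 mul0r.
apply: (IH c' c'0 f g').
  move: cn; rewrite cE size_Mmonic ?monicXsubC // size_XsubC addn2.
  by move=> /leq_trans; apply.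
have Xt0' : ('X - t%:P)%:P != 0 :> sy by rewrite polyC_eq0.
by apply: (mulfI Xt0'); rewrite !mulrA -gE -E cE polyCM; ring.
Qed.

Lemma primitive_part (f : sy) : f != 0 ->
  exists c g, [/\ c != 0, f = c%:P * g & primitive g].
Proof.
have [n] := ubnP (size (lead_coef f)).
elim: n f => // n IH f; rewrite ltnS => fn f0.
have [prim|] := EM (primitive f).
  by exists 1, f; rewrite oner_eq0 polyC1 mul1r.
move=> /existsNP[t /negP/negPn/eqP/at_y_eq0[g gE]].
have Xt0 : ('X - t%:P : {poly C}) != 0 by rewrite polyXsubC_eq0.
have g0 : g != 0 by apply: contraNneq f0 => g0; rewrite gE g0 mulr0.
have [|//|c [h [c0 hE prim]]] := IH g.
  move: fn; rewrite gE lead_coefM lead_coefC size_mul ?lead_coef_eq0 //.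
  by rewrite size_XsubC.
exists (('X - t%:P) * c), h; split=> //; first by rewrite mulf_neq0.
by rewrite gE hE polyCM mulrA.
Qed.

End Gauss.

Section Descent.
Variable C : numClosedFieldType.
Notation sy := {poly {poly C}}.
Implicit Types f g : sy.

Lemma sy_vfield4M f g : sy_vfield4 (f * g) = sy_vfield4 f * g + f * sy_vfield4 g.
Proof. by rewrite /sy_vfield4 derivM derivyM; ring. Qed.

Lemma sy_no_darboux f k : sy_vfield4 f = k * f -> exists c, f = c%:P%:P.
Proof.
move=> fk; exists (xy_of_sy f)@_0; rewrite -sy_of_xyC.
rewrite -(no_darboux_polynomial (K := xy_of_sy k)) ?xy_of_syK //.
by rewrite -[vfield4 _]sy_of_xyK sy_of_xy_vfield4 !xy_of_syK fk rmorphM.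
Qed.

(** The coefficient [x (x + y^2)] of [dx] in [omega4]. *)
Definition sy_a : sy := 'X * ('X - ('X ^+ 2)%:P).

Lemma sy_vfield4C (c : {poly C}) : sy_vfield4 c%:P = - (sy_a * (c^`())%:P).
Proof. by rewrite /sy_vfield4 /sy_a derivC derivyC mulr0 sub0r. Qed.

Section Ideal.
Variable I : sy -> Prop.
Hypothesis IM : forall g f, I f -> I (g * f).
Hypothesis IB : forall f g, I f -> I g -> I (f - g).
Hypothesis Ider : forall f, I f -> I (sy_vfield4 f).
Hypothesis Isa : forall f, I (sy_a * f) -> I f.

(** Pseudo-division of the derivative of [f] by [f] either produces an element of
   smaller degree in [s] or shows, by Gauss's lemma, that the primitive part of
   [f] is a Darboux polynomial; the latter is a constant. *)
Lemma stable_ideal_meets_y f : f != 0 -> I f ->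
  exists c : {poly C}, c != 0 /\ I c%:P.
Proof.
have [n] := ubnP (size f); elim: n f => // n IH f; rewrite ltnS => fn f0 If.
pose q := (sy_vfield4 f %/ f); pose r := (sy_vfield4 f %% f).
pose lc := lead_coef f ^+ scalp (sy_vfield4 f) f.
have lc0 : lc != 0 by rewrite expf_neq0 // lead_coef_eq0.
have dE : lc%:P * sy_vfield4 f = q * f + r.
  by rewrite mul_polyC /lc /q /r Pdiv.Idomain.divp_eq.
have [r0|r0] := eqVneq r 0; last first.
  apply: (IH r) => //.
    by apply: leq_trans fn; rewrite /r Pdiv.CommonIdomain.ltn_modp.
  have -> : r = lc%:P * sy_vfield4 f - q * f by rewrite dE addrC addKr.
  by apply: IB; apply: IM => //; apply: Ider.
have [c [g [c0 fE prim]]] := primitive_part f0.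
have [k gk] : exists k, sy_vfield4 g = k * g.
  have lcc0 : lc * c != 0 by rewrite mulf_neq0.
  apply: (gauss lcc0 prim (g := q * c%:P + lc%:P * (sy_a * (c^`())%:P))).
  move: dE; rewrite r0 addr0 fE sy_vfield4M sy_vfield4C polyCM => dE.
  transitivity (lc%:P * (- (sy_a * (c^`())%:P) * g + c%:P * sy_vfield4 g)
     + lc%:P * sy_a * (c^`())%:P * g); first by ring.
  by rewrite dE; ring.
have [z gz] := sy_no_darboux gk.
exists (c * z%:P); rewrite polyCM -gz -fE; split=> //.
by apply: contraNneq f0 => c'0; rewrite fE gz -polyCM c'0.
Qed.

(** On polynomials in [y] alone the vector field acts as [- a d/dy], and [a] can
   be cancelled, so the ideal is stable under [d/dy] and contains 1. *)
Lemma stable_ideal_unit f : f != 0 -> I f -> I 1.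
Proof.
move=> f0 /(stable_ideal_meets_y f0) [c [c0 Ic]] {f f0}.
have [n] := ubnP (size c); elim: n c c0 Ic => // n IH c c0 Ic.
rewrite ltnS => cn; have [c1|c1] := leqP (size c) 1%N.
  have cE := size1_polyC c1.
  have z0 : c`_0 != 0 by apply: contraNneq c0 => z0; rewrite cE z0.
  have -> : (1 : sy) = (c`_0)^-1%:P%:P * c%:P.
    by rewrite [in X in _ * X]cE -!polyCM mulVf.
  exact: IM.
have c'0 : c^`() != 0.
  apply: contraTneq c1 => c'0; rewrite -leqNgt; have := coef_deriv c (size c).-2.
  rewrite c'0 coef0; case E: (size c) => [|[|k]] //= /esym/eqP.
  have ck : c`_k.+1 = lead_coef c by rewrite lead_coefE E.
  by rewrite ck mulrn_eq0 /= lead_coef_eq0 (negbTE c0).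
apply: (IH c^`()) => //; last by apply: leq_trans (lt_size_deriv c0) cn.
apply: Isa.
have -> : sy_a * (c^`())%:P = (-1) * sy_vfield4 c%:P by rewrite sy_vfield4C; ring.
by apply: IM; apply: Ider.
Qed.

End Ideal.

Lemma sy_a_neq0 : sy_a != 0.
Proof. by rewrite mulf_neq0 ?polyX_eq0 // polyXsubC_eq0. Qed.

Lemma deriv_sy_a : sy_a^`() = 2%:R * 'X - ('X ^+ 2)%:P.
Proof. rewrite /sy_a derivM derivB derivX derivC; ring. Qed.

Lemma derivy_sy_a : derivy sy_a = - (2%:R * 'X * 'X%:P).
Proof.
rewrite /sy_a derivyM derivyB !derivyX derivyC derivXn /= expr1 sub0r mul0r add0r.
by rewrite polyCMn; ring.
Qed.

Lemma horner_nat n (x : {poly C}) : (n%:R : sy).[x] = n%:R.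
Proof. by rewrite hornerMn -polyC1 hornerC. Qed.

Let hE := (hornerD, hornerN, horner_nat, hornerM, hornerC, hornerX).

Lemma sy_vfield4_sy_a_at0 : (sy_vfield4 sy_a).[0] = 'X ^+ 7.
Proof.
rewrite /sy_vfield4 deriv_sy_a derivy_sy_a !hE; ring.
Qed.

Lemma sy_vfield4_sy_a_atX2 : (sy_vfield4 sy_a).['X ^+ 2] = 'X ^+ 4.
Proof.
rewrite /sy_vfield4 deriv_sy_a derivy_sy_a !hE; ring.
Qed.

(** The curve [a = 0] consists of [s = 0] and [s = y^2], and the vector field is
   tangent to neither of them. *)
Lemma dvd_sy_a (P Q : sy) n : P * sy_vfield4 sy_a *+ n.+1 = sy_a * Q ->
  exists R, P = sy_a * R.
Proof.
move=> E.
have root_of x : sy_a.[x] = 0 -> (sy_vfield4 sy_a).[x] != 0 -> root P x.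
  move=> x0 Dx; have := congr1 (fun p => p.[x]) E.
  rewrite /= hornerMn (hornerM P) (hornerM sy_a) x0 mul0r => /eqP.
  have nz : n.+1%:R != 0 :> {poly C} by rewrite -polyC_natr polyC_eq0 pnatr_eq0.
  by rewrite -mulr_natl !mulf_eq0 (negbTE nz) (negbTE Dx) orbF.
have /factor_theorem[P1 PE] : root P 0.
  apply: root_of; first by rewrite /sy_a !hE mul0r.
  by rewrite sy_vfield4_sy_a_at0 expf_neq0 // polyX_eq0.
have /factor_theorem[P2 P1E] : root P1 ('X ^+ 2).
  have : root P ('X ^+ 2).
    apply: root_of; first by rewrite /sy_a !hE subrr mulr0.
    by rewrite sy_vfield4_sy_a_atX2 expf_neq0 // polyX_eq0.
  by rewrite PE rootM orbC root_XsubC expf_eq0 polyX_eq0.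
by exists P2; rewrite PE P1E subr0 /sy_a; ring.
Qed.

(** The equation of [projective_triple_potential] for [k = P / a^n], without
   denominators; [N / a^4] is its right-hand side. *)
Definition polar_equation (dl N : sy) n (P : sy) : Prop :=
  sy_a ^+ 4 * (sy_a * sy_vfield4 P - n%:R * P * sy_vfield4 sy_a + 2%:R * dl * sy_a * P)
    = N * sy_a ^+ n.+1.

(** The vector field is transverse to [a = 0], so it raises by one the order of a
   pole along that curve. As the right-hand side has a pole of order at
   most 4, that of [k] has order at most 3. *)
Lemma polar_equation_order3 dl N n P : polar_equation dl N n P ->
  exists Q, sy_a * sy_vfield4 Q - 3%:R * Q * sy_vfield4 sy_a + 2%:R * dl * sy_a * Q = N.
Proof.
have a40 : sy_a ^+ 4 != 0 by rewrite expf_neq0 // sy_a_neq0.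
have small k R : (k <= 3)%N -> polar_equation dl N k R ->
    exists Q, sy_a * sy_vfield4 Q - 3%:R * Q * sy_vfield4 sy_a + 2%:R * dl * sy_a * Q = N.
  move=> k3 E; exists (sy_a ^+ (3 - k) * R); apply: (mulfI a40).
  have aD := derivation_expr sy_a sy_vfield4M (3 - k).
  transitivity (sy_a ^+ (3 - k) * (sy_a ^+ 4 * (sy_a * sy_vfield4 R
      - k%:R * R * sy_vfield4 sy_a + 2%:R * dl * sy_a * R))).
    have -> : k%:R = 3%:R - (3 - k)%:R :> sy by rewrite natrB // opprB addrC subrK.
    rewrite sy_vfield4M; move: (sy_a ^+ (3 - k)) aD => u aD.
    transitivity (sy_a ^+ 4 * ((sy_a * sy_vfield4 u) * R + sy_a * u * sy_vfield4 R
        - 3%:R * (u * R) * sy_vfield4 sy_a + 2%:R * dl * sy_a * (u * R))); first by ring.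
    by rewrite aD; ring.
  by rewrite E mulrCA -exprD -(subSS k) addnC subnKC // mulrC.
elim: n P => [|n IH] P E; first exact: small E.
have [n3|n3] := leqP n.+1 3; first exact: small E.
have E1 : sy_a * sy_vfield4 P - n.+1%:R * P * sy_vfield4 sy_a + 2%:R * dl * sy_a * P
    = N * sy_a ^+ (n - 3) * sy_a.
  apply: (mulfI a40); rewrite E (_ : n.+2 = 4 + (n - 3) + 1)%N ?exprD; last by lia.
  by ring.
have [R PE] : exists R, P = sy_a * R.
  apply: (dvd_sy_a (n := n) (Q := sy_vfield4 P + 2%:R * dl * P - N * sy_a ^+ (n - 3))).
  rewrite -mulr_natr; apply/eqP; rewrite -subr_eq0; apply/eqP.
  transitivity (N * sy_a ^+ (n - 3) * sy_a - (sy_a * sy_vfield4 P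
      - n.+1%:R * P * sy_vfield4 sy_a + 2%:R * dl * sy_a * P)); first by ring.
  by rewrite E1 subrr.
have ER : polar_equation dl N n R.
  apply: (mulfI sy_a_neq0); rewrite /polar_equation.
  transitivity (sy_a ^+ 4 * (sy_a * sy_vfield4 P - n.+1%:R * P * sy_vfield4 sy_a
      + 2%:R * dl * sy_a * P)).
    by rewrite PE sy_vfield4M -[n.+1]addn1 natrD; ring.
  by rewrite E [sy_a ^+ n.+2]exprS; ring.
exact: IH ER.
Qed.

(** The divergence [1 - 4 x y] of the vector field, in the coordinates [s], [y]. *)
Definition sy_delta : sy := 1 - 4%:R * 'X * 'X%:P + 4%:R * ('X ^+ 3)%:P.

(** [- d (d (dl / a) / a)] equals [potential_source d a dl / a^4]. *)
Definition potential_source (T : comNzRingType) (d : T -> T) (a dl : T) : T :=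
  let m := d dl * a - dl * d a in 3%:R * m * d a - a * d m.

(** Restriction to [s = 0], where [a] vanishes, leaves
   [- 3 Q y^7 = - 3 y^4 - 12 y^7], and [y^7] does not divide [y^4]. *)
Lemma no_polar_solution Q :
  sy_a * sy_vfield4 Q - 3%:R * Q * sy_vfield4 sy_a + 2%:R * sy_delta * sy_a * Q
    <> potential_source (@deriv _) sy_a sy_delta.
Proof.
move=> E; have := congr1 (fun f => f.[0]) E.
have sa0 : sy_a.[0] = 0 by rewrite /sy_a !hE mul0r.
have dsa0 : sy_a^`().[0] = - 'X ^+ 2 by rewrite deriv_sy_a !hE mulr0 sub0r.
have sd0 : sy_delta.[0] = 1 + 4%:R * 'X ^+ 3.
  by rewrite /sy_delta !hE mulr0 mul0r subr0.
have Dsa0 := sy_vfield4_sy_a_at0.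
rewrite /potential_source.
move: sy_delta sy_a (sy_vfield4 sy_a) (sy_a^`()) dsa0 Dsa0 sa0 sd0 {E}.
move=> dl z Dz dz dz0 Dz0 z0 dl0; rewrite !hE z0 dz0 Dz0 dl0 => H.
have : (- 3%:R * Q.[0]) * 'X ^+ 7 = (-3%:R)%:P * 'X ^+ 4 + (- 12%:R)%:P * 'X ^+ 7.
  by etransitivity; [|etransitivity; [exact: H|]]; rewrite ?rmorphN ?rmorph_nat; ring.
move/(congr1 (fun p : {poly C} => p`_4)).
rewrite coefMXn coefD !coefCM !coefXn /= mulr1 mulr0 addr0 => /esym/eqP.
by rewrite oppr_eq0 pnatr_eq0.
Qed.

(** The denominators of a solution form an ideal that is stable under the vector
   field; in the absence of Darboux polynomials it is the unit ideal, so the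
   solution is polynomial up to a power of [a]. *)
Lemma no_rational_solution (A B : sy) : B != 0 ->
  sy_a ^+ 4 * (sy_vfield4 A * B - A * sy_vfield4 B + 2%:R * sy_delta * A * B)
    <> potential_source (@deriv _) sy_a sy_delta * B ^+ 2.
Proof.
move=> B0 E.
have BI : denominator sy_a A B B by exists 0%N, A; rewrite expr0 mulr1 mulrC.
have [n [P H]] : denominator sy_a A B 1.
  apply: (stable_ideal_unit (I := denominator sy_a A B)) BI => //.
  - by move=> g f; apply: denominatorMl.
  - by move=> f g; apply: denominatorB.
  - exact: (denominator_der sy_vfield4M B0 E).
  - by move=> f; apply: denominator_cancel.
rewrite mul1r in H.
have [Q] := polar_equation_order3 (denominator1_equation sy_vfield4M B0 E H).
exact: no_polar_solution.
Qed.

End Descent.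

(** * The foliation is not transversally projective *)

(** The equation of [projective_triple_potential] for [k = p / q], without
   denominators. *)
Lemma quotient_potential (R : idomainType) (F : fieldType)
    (iota : {rmorphism R -> F}) (d e : R -> R) (D E : F -> F) (a b dl p q : R) :
    (forall p, (iota p == 0) = (p == 0)) ->
    (forall p q, d (p * q) = d p * q + p * d q) ->
    quotient_derivation iota d D -> quotient_derivation iota e E ->
    a != 0 -> q != 0 ->
    iota b * D (iota p / iota q) - iota a * E (iota p / iota q)
      + 2%:R * iota dl * (iota p / iota q) = - D (D (iota dl / iota a) / iota a) ->
  a ^+ 4 * ((b * d p - a * e p) * q - p * (b * d q - a * e q)
    + 2%:R * dl * p * q) = potential_source d a dl * q ^+ 2.
Proof.
move=> iota_eq0 dM DE EE a0 q0.
have Fa0 : iota a != 0 by rewrite iota_eq0.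
have Fq0 : iota q != 0 by rewrite iota_eq0.
pose m := d dl * a - dl * d a.
have -> : D (iota dl / iota a) / iota a = iota m / iota (a ^+ 3).
  by rewrite DE // -/m rmorphXn /=; move: (iota m) => m'; field.
have d3 : d (a ^+ 3) = 3%:R * a ^+ 2 * d a.
  by rewrite !exprS expr0 mulr1 !dM; ring.
rewrite !DE ?EE ?expf_neq0 // d3 => H.
apply/eqP; rewrite -subr_eq0 -iota_eq0 /potential_source -/m; apply/eqP.
clearbody m; move: H; rewrite !(rmorphB, rmorphD, rmorphM, rmorphXn, rmorph_nat) /=.
move=> /eqP; rewrite -subr_eq0 => /eqP H.
rewrite -[RHS](mulr0 (iota a ^+ 4 * iota q ^+ 2)) -[X in _ = _ * X]H.
by field; rewrite Fa0.
Qed.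

Section NotTransversallyProjective.
Variable C : numClosedFieldType.
Notation xy := {mpoly C[2]}.
Notation ratfun := {fraction xy}.

Let a : xy := (omega4 C).1.
Let b : xy := (omega4 C).2.
Let dl : xy := b^`M(0) - a^`M(1).

Lemma sy_of_xy_a : sy_of_xy a = sy_a C.
Proof.
by rewrite /a /omega4 /= !sy_of_xyE !sy_of_xyX /= polyC_exp /sy_a polyC_exp; ring.
Qed.

Lemma sy_of_xy_dl : sy_of_xy dl = sy_delta C.
Proof.
transitivity (sy_of_xy b^`M(0) - sy_of_xy a^`M(1)); first exact: rmorphB.
rewrite (sy_of_xy_der b).1 (sy_of_xy_der a).2 sy_of_xy_a.
have -> : sy_of_xy b = 'X - ('X - ('X ^+ 2)%:P) ^+ 2 * 'X%:P.
  rewrite /b /omega4 /= !sy_of_xyE !sy_of_xyX /=.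
  by rewrite polyC_exp; ring.
rewrite derivy_sy_a deriv_sy_a derivB derivM derivX !derivC expr2.
rewrite derivM derivB derivX derivC.
by rewrite /sy_delta !polyC_exp polyCM -polyC_natr; ring.
Qed.

Lemma xy_no_rational_solution (p q : xy) : q != 0 ->
  a ^+ 4 * (vfield4 p * q - p * vfield4 q + 2%:R * dl * p * q)
    <> potential_source (mderiv 0) a dl * q ^+ 2.
Proof.
move=> q0 /(congr1 (@sy_of_xy C)) E.
have Q0 : sy_of_xy q != 0.
  by apply: contraNneq q0 => Q0; rewrite -[q]sy_of_xyK Q0 rmorph0.
apply: (no_rational_solution (A := sy_of_xy p) Q0).
have dE u : sy_of_xy (u^`M(0)) = (sy_of_xy u)^`() := (sy_of_xy_der u).1.
move: E; rewrite /potential_source.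
by rewrite !(@sy_of_xy_vfield4 C, sy_of_xy_a, sy_of_xy_dl, dE, sy_of_xyE).
Qed.

Lemma omega4_no_potential (k : ratfun) :
  let A := tofrac a in let dA := tofrac dl in
  tofrac b * rderiv 0 k - A * rderiv 1 k + 2%:R * dA * k
    <> - rderiv 0 (rderiv 0 (dA / A) / A).
Proof.
move=> A dA; have [p [q [q0 ->]]] := ratfun_frac k => E.
apply: (xy_no_rational_solution (p := p) q0).
have a0 : a != 0 by apply: contraNneq (sy_a_neq0 C) => a0; rewrite -sy_of_xy_a a0 rmorph0.
apply: (quotient_potential (@tofrac_eq0 _) _ (@rderivE _ 0) (@rderivE _ 1) a0 q0 E).
exact: mderivM.
Qed.

Lemma not_transversally_projective (w : hform C) :
    (exists2 c : C, c != 0 & chart w = c *: omega4 C) ->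
  ~ transversally_projective w.
Proof.
move=> [c c0 wE] [t0 [t1 [t2 [[t00 t0w] E0 E1 E2]]]].
have w0E : (ratchart w).1 = tofrac c%:MP * tofrac a.
  by rewrite /ratchart wE /= -mul_mpolyC tofracM.
have w1E : (ratchart w).2 = tofrac c%:MP * tofrac b.
  by rewrite /ratchart wE /= -mul_mpolyC tofracM.
have Fc0 : tofrac (c%:MP : xy) != 0 by rewrite tofrac_eq0 mpolyC_eq0.
have a0 : a != 0 by apply: contraNneq (sy_a_neq0 C) => a0; rewrite -sy_of_xy_a a0 rmorph0.
have Fa0 : tofrac a != 0 by rewrite tofrac_eq0.
have prop : fwedge t0 (tofrac a, tofrac b) = 0.
  apply: (mulfI Fc0); rewrite mulr0 -t0w /wedge w0E w1E /fwedge /=.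
  move: t0.1 t0.2 => u v; ring.
have two0 : 2%:R != 0 :> ratfun.
  rewrite -(rmorph_nat (@tofrac _)) tofrac_eq0 -(rmorph_nat (@mpolyC _ _)).
  by rewrite mpolyC_eq0 pnatr_eq0.
have T : projective_triple (@rderiv C 0) (@rderiv C 1) t0 t1 t2 by split.
have [k] := projective_triple_potential (@rderiv_derivation C 0)
  (@rderiv_derivation C 1) (@rderiv_comm C 0 1) two0 Fa0 t00 prop T.
rewrite !rderiv_tofrac -tofracB.
exact: omega4_no_potential.
Qed.

End NotTransversallyProjective.

Theorem proposition1p3 (R : realType) (w : hform R[i])
    (w_foliation : is_foliation 2 w)
    (w_chart : exists2 c : R[i], c != 0 & chart w = c *: omega4 R[i]) :
  (~ exists f : {mpoly (R[i])[3]}, invariant_curve w f) /\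
  ~ transversally_projective w.
Proof.
by split; [exact: no_invariant_curve | exact: not_transversally_projective].
Qed.
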